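(* Let $\Omega\subset\mathbb{R}^d$ ($d=2,3$) be a bounded polyhedral domain, $\kappa\in\mathbb{R}$, $\sigma\in\mathbb{R}$, $\sigma>0$. Let $V_h$ be the first-order finite element space on a quasi-uniform triangulation of mesh size $h$, with nodal basis $\varphi_1,\dots,\varphi_n$, and let $A_{j,i}=a(\varphi_i,\varphi_j)$, $K_{j,i}=(\nabla\varphi_i,\nabla\varphi_j)$, $M_{j,i}=(\varphi_i,\varphi_j)$. Then there exist constants $c,C>0$, independent of $h$, $\sigma$ and $\kappa$, such that $$\mathcal{F}(AK^{-1}M)\subset\Big\{z\in\mathbb{C}:\ ch^d-\frac{\kappa^2}{\sigma}\Im z\le\Re z\le Ch^d-\frac{\kappa^2}{\sigma}\Im z\Big\}.$$
   Context: $a(u,v)=(\nabla u,\nabla v)-\kappa^2(u,v)+\mathrm{i}\sigma(u,v)$ with $(u,v)=\int_\Omega u\bar v$. $V_h=\{u\in H^1_0(\Omega): u|_T\in P_1(T)\ \forall T\}$. For $B\in\mathbb{C}^{n\times n}$, $\mathcal{F}(B)=\{x^*Bx/x^*x:\ x\in\mathbb{C}^n,\ x\neq0\}$. *)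

(* Defs.v *)
From HB Require Import structures.
From mathcomp Require Import all_boot all_order all_algebra.
From mathcomp Require Import all_classical all_reals all_analysis.
From mathcomp Require Import complex.

Set Implicit Arguments.
Unset Strict Implicit.
Unset Printing Implicit Defensive.

Import Order.TTheory GRing.Theory Num.Theory.
Import numFieldNormedType.Exports.
Local Open Scope classical_set_scope.
Local Open Scope ring_scope.
Local Open Scope complex_scope.

Fixpoint iint (R : realType) (d : nat) : ('rV[R]_d -> R) -> R :=
  match d return ('rV[R]_d -> R) -> R with
  | 0 => fun f => f 0
  | d'.+1 => fun f =>
      \int[@lebesgue_measure R]_t
        iint (fun y : 'rV[R]_d' => f (row_mx (const_mx t : 'rV[R]_1) y))
  end.

Section FEM.
Variables (R : realType) (d : nat).
Local Notation pt := 'rV[R]_d.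

Definition edot (x y : pt) : R := \sum_(k < d) x 0 k * y 0 k.
Definition enorm (x : pt) : R := Num.sqrt (edot x x).

Definition simplex := {ffun 'I_d.+1 -> pt}.

Definition nondegenerate (T : simplex) : bool :=
  \det (\matrix_(i < d, k < d) (T (lift ord0 i) 0 k - T ord0 0 k)) != 0.

(* convex hull of a finite list of points (empty for the empty list) *)
Definition conv (s : seq pt) : set pt :=
  [set x | exists l : 'I_(size s) -> R,
     (forall i, 0 <= l i) /\ \sum_i l i = 1 /\ x = \sum_i l i *: s`_i].

Definition hull (T : simplex) : set pt := conv (codom T).

Definition polyhedral_domain (Om : set pt) : Prop :=
  open Om /\ connected Om /\ bounded_set Om /\
  exists Ts : seq simplex, (forall T, T \in Ts -> nondegenerate T) /\
     closure Om = \bigcup_(T in [set T | T \in Ts]) hull T.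

Definition triangulation (Om : set pt) (Ts : seq simplex) : Prop :=
  (forall T, T \in Ts -> nondegenerate T) /\
  closure Om = \bigcup_(T in [set T | T \in Ts]) hull T /\
  (forall T T', T \in Ts -> T' \in Ts -> T != T' ->
     hull T `&` hull T' = conv [seq v <- codom T | v \in codom T']).

Definition diam (T : simplex) : R :=
  \big[Num.max/0]_(k < d.+1) \big[Num.max/0]_(l < d.+1) enorm (T k - T l).
Definition mesh_size (Ts : seq simplex) : R := \big[Num.max/0]_(T <- Ts) diam T.

Definition quasi_uniform (rho : R) (Ts : seq simplex) : Prop :=
  forall T, T \in Ts -> exists c : pt,
    forall y : pt, enorm (y - c) <= rho * mesh_size Ts -> hull T y.

(* V_h : continuous piecewise-P1 functions vanishing outside Omega
   (H^1_0-functions extended by zero) *)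
Definition Vh (Om : set pt) (Ts : seq simplex) : set (pt -> R) :=
  [set u | continuous u /\ (forall x, ~ Om x -> u x = 0) /\
     forall T, T \in Ts -> exists (b : R) (w : pt),
        forall x, hull T x -> u x = b + edot w x].

Definition is_vertex (Ts : seq simplex) (x : pt) : Prop :=
  exists2 T, T \in Ts & exists k, x = T k.

Definition nodal_basis (Om : set pt) (Ts : seq simplex) (n : nat)
    (p : 'I_n -> pt) (phi : 'I_n -> pt -> R) : Prop :=
  injective p /\
  (forall i, is_vertex Ts (p i) /\ Om (p i)) /\
  (forall x, is_vertex Ts x -> Om x -> exists i, p i = x) /\
  (forall i, Vh Om Ts (phi i)) /\
  (forall i j, phi i (p j) = (i == j)%:R).

Definition intOm (Om : set pt) (f : pt -> R) : R :=
  iint (fun x => \1_Om x * f x).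

Definition l2ip (Om : set pt) (u v : pt -> R) : R := intOm Om (fun x => u x * v x).
Definition unit_vec (k : 'I_d) : pt := delta_mx 0 k.
Definition gradip (Om : set pt) (u v : pt -> R) : R :=
  intOm Om (fun x => \sum_(k < d) ('D_(unit_vec k) u x) * ('D_(unit_vec k) v x)).

Definition aform (Om : set pt) (kappa sigma : R) (u v : pt -> R) : R[i] :=
  (gradip Om u v)%:C - (kappa ^+ 2 * l2ip Om u v)%:C
  + 'i * (sigma * l2ip Om u v)%:C.

Definition Amat (Om : set pt) (kappa sigma : R) (n : nat) (phi : 'I_n -> pt -> R)
  : 'M[R[i]]_n := \matrix_(j, i) aform Om kappa sigma (phi i) (phi j).
Definition Kmat (Om : set pt) (n : nat) (phi : 'I_n -> pt -> R) : 'M[R[i]]_n :=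
  \matrix_(j, i) (gradip Om (phi i) (phi j))%:C.
Definition Mmat (Om : set pt) (n : nat) (phi : 'I_n -> pt -> R) : 'M[R[i]]_n :=
  \matrix_(j, i) (l2ip Om (phi i) (phi j))%:C.

End FEM.

Definition adjv (R : rcfType) (n : nat) (x : 'cV[R[i]]_n) : 'rV[R[i]]_n :=
  (map_mx (@conjc R) x)^T.
Definition field_of_values (R : rcfType) (n : nat) (B : 'M[R[i]]_n) : set R[i] :=
  [set z | exists x : 'cV[R[i]]_n, x != 0 /\
     z = (adjv x *m B *m x) 0 0 / (adjv x *m x) 0 0].

(* Main.v *)
Require Import Defs.
From HB Require Import structures.
From mathcomp Require Import all_boot all_order all_algebra.
From mathcomp Require Import all_classical all_reals all_analysis.
From mathcomp Require Import complex.
From mathcomp Require Import measurable_realfun ring lra.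
Import Order.TTheory GRing.Theory Num.Theory.
Import numFieldNormedType.Exports.
Local Open Scope classical_set_scope.
Local Open Scope ring_scope.

Set Implicit Arguments.
Unset Strict Implicit.
Unset Printing Implicit Defensive.

(* Write A = K + (-kappa^2 + i sigma) M.  Then A K^-1 M = M + (-kappa^2 + i sigma) M K^-1 M,
   and M, M K^-1 M are real symmetric, so Re z + (kappa^2/sigma) Im z is the Rayleigh
   quotient x^* M x / x^* x: everything reduces to the bounds c h^d <= M <= C h^d, once K is
   known to be invertible.

   Upper bound: on a simplex |u| is at most its largest vertex value, so u^2 is dominated by
   the sum of u(p_i)^2 over the vertices p_i whose cube of half-side h contains the point.
   Lower bound: the ball inscribed in a simplex having p_i as a vertex contains a cube of side
   proportional to h on which |u| dominates |u(p_i)|; at most d + 1 of these cubes meet at a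
   point, since simplices sharing an interior point have the same vertices.

   Invertibility of K: if the energy of u vanishes, u is constant on each simplex, hence takes
   finitely many values; being continuous and zero outside the bounded set Om, it is zero.
   The gradient of u is piecewise constant off finitely many hyperplanes, and modifying an
   integrand there changes, at each level of the iterated integral, only finitely many points. *)

(** * Borel functions *)

Section Measurability.
Variable R : realType.

Definition coord_measurable (d : nat) disp (X : measurableType disp)
    (h : X -> 'rV[R]_d) : Prop :=
  forall k, measurable_fun setT (fun x => h x 0 k).

(* Stands for Borel measurability on [R^d]: no sigma-algebra is put on ['rV[R]_d]; instead
   the function is composed with arbitrary maps that have measurable coordinates. *)
Definition borel_fun (d : nat) (f : 'rV[R]_d -> R) : Prop :=
  forall disp (X : measurableType disp) (h : X -> 'rV[R]_d),
    coord_measurable h -> measurable_fun setT (fun x => f (h x)).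

(** Joint measurability in the parameter and the point. Measurability in each variable separately
    would not give the measurable dependence on the parameter that the induction on dimension in
    [measurable_iint] uses. *)
Definition borel_family (d : nat) disp (X : measurableType disp)
    (F : X -> 'rV[R]_d -> R) : Prop :=
  forall disp' (Y : measurableType disp') (a : Y -> X) (h : Y -> 'rV[R]_d),
    measurable_fun setT a -> coord_measurable h ->
    measurable_fun setT (fun y => F (a y) (h y)).

Lemma coord_measurable_cons (d : nat) disp (X : measurableType disp)
    (a : X -> R) (h : X -> 'rV[R]_d) :
  measurable_fun setT a -> coord_measurable h ->
  @coord_measurable d.+1 _ X (fun x => row_mx (const_mx (a x) : 'rV_1) (h x)).
Proof.
move=> ma mh k.
case: (@split_ordP 1 d k) => j ->.
  by apply: (eq_measurable_fun a) => // x _; rewrite (@row_mxEl _ _ 1 d) mxE.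
by apply: (eq_measurable_fun (fun x => h x 0 j)) => // x _; rewrite (@row_mxEr _ _ 1 d).
Qed.

(** Tonelli is applied to the positive and the negative part separately, so [g] need not be
    integrable in [t]. Where both parts are infinite the value is conventional, but the difference
    and [fine] are still measurable. *)
Lemma measurable_Rintegral_param disp (X : measurableType disp)
    (g : X * measurableTypeR R -> R) :
  measurable_fun setT g ->
  measurable_fun setT (fun x => \int[@lebesgue_measure R]_t g (x, t)).
Proof.
move=> mg; rewrite /Rintegral.
apply: (measurableT_comp (@fine_measurable R setT measurableT)).
have mG : measurable_fun setT (EFin \o g) by exact/measurable_EFinP.
have h1 := measurable_fun_fubini_tonelli_F (m2 := @lebesgue_measure R)
   (EFin \o g)^\+%E (measurable_funepos mG) (funepos_ge0 _).
have h2 := measurable_fun_fubini_tonelli_F (m2 := @lebesgue_measure R)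
   (EFin \o g)^\-%E (measurable_funeneg mG) (funeneg_ge0 _).
apply: eq_measurable_fun (emeasurable_funB h1 h2) => x _.
rewrite [RHS]integralE; congr (_ - _)%E; apply: eq_integral => t _.
  by rewrite !funeposE.
by rewrite !funenegE.
Qed.

(** Induction on the dimension with the parameter space generalised: the outer integration variable
    joins the parameter, so the inner iterated integral is a measurable function on [X * R]. *)
Lemma measurable_iint (d : nat) disp (X : measurableType disp)
    (F : X -> 'rV[R]_d -> R) :
  borel_family F -> measurable_fun setT (fun x => iint (F x)).
Proof.
elim: d disp X F => [|d IH] disp X F mF /=.
  by apply: (mF _ X id (fun=> 0)) => //; case.
pose g (p : X * measurableTypeR R) :=
  iint (fun y : 'rV[R]_d => F p.1 (row_mx (const_mx p.2 : 'rV[R]_1) y)).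
apply: (@measurable_Rintegral_param _ X g).
apply: IH => disp' Y a h ma mh.
apply: (mF _ _ (fst \o a)) => /=; first exact: measurableT_comp.
by apply: coord_measurable_cons => //; exact: (measurableT_comp measurable_snd ma).
Qed.

Lemma borel_family_slice (d : nat) (f : 'rV[R]_d.+1 -> R) : borel_fun f ->
  borel_family (fun (t : measurableTypeR R) y => f (row_mx (const_mx t : 'rV[R]_1) y)).
Proof. by move=> mf disp Y a h ma mh; apply: mf; exact: coord_measurable_cons. Qed.

Lemma borel_fun_slice (d : nat) (f : 'rV[R]_d.+1 -> R) t : borel_fun f ->
  borel_fun (fun y : 'rV[R]_d => f (row_mx (const_mx t : 'rV[R]_1) y)).
Proof. by move=> mf disp Y h mh; apply: mf; exact: coord_measurable_cons. Qed.

Lemma borel_funD d (f g : 'rV[R]_d -> R) :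
  borel_fun f -> borel_fun g -> borel_fun (fun x => f x + g x).
Proof. by move=> mf mg disp X h mh; apply: measurable_funD; [exact: mf|exact: mg]. Qed.

Lemma borel_funM d (f g : 'rV[R]_d -> R) :
  borel_fun f -> borel_fun g -> borel_fun (fun x => f x * g x).
Proof. by move=> mf mg disp X h mh; apply: measurable_funM; [exact: mf|exact: mg]. Qed.

Lemma borel_fun_cst d (c : R) : borel_fun (fun _ : 'rV[R]_d => c).
Proof. by move=> disp X h mh; exact: measurable_cst. Qed.

Lemma borel_fun_sum d (I : Type) (r : seq I) (P : pred I) (F : I -> 'rV[R]_d -> R) :
  (forall i, borel_fun (F i)) -> borel_fun (fun x => \sum_(i <- r | P i) F i x).
Proof.
move=> mF; elim: r => [|i r IH].
  by under eq_fun do rewrite big_nil; exact: borel_fun_cst.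
under eq_fun do rewrite big_cons.
by case: (P i) => //; exact: borel_funD (mF i) IH.
Qed.

Lemma mx_ballE (d : nat) (x y : 'rV[R]_d) (e : R) :
  0 < e -> ball x e y <-> forall k, `|x 0 k - y 0 k| < e.
Proof.
move=> e0; split=> [[_ h] k|h]; first exact: h.
by split=> // i k; rewrite ord1; exact: h.
Qed.

Lemma open_ballP (d : nat) (U : set 'rV[R]_d) x : open U -> U x ->
  exists2 e : R, 0 < e & forall y : 'rV[R]_d, (forall k, `|x 0 k - y 0 k| < e) -> U y.
Proof.
move=> oU Ux.
have /nbhs_ballP[e /= e0 he] : nbhs x U by exact: open_nbhs_nbhs.
by exists e => // y hy; apply: he; apply/mx_ballE.
Qed.

(* [U] is the union of the boxes of rational centre and radius [1/(n+1)] it contains. *)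
Lemma measurable_preimage_open (d : nat) disp (X : measurableType disp)
    (h : X -> 'rV[R]_d) (U : set 'rV[R]_d) :
  coord_measurable h -> open U -> measurable (h @^-1` U).
Proof.
move=> mh oU.
pose D : set (('rV[rat]_d * nat)%type) :=
  [set q : 'rV[rat]_d * nat | forall y : 'rV[R]_d,
     (forall k, `|ratr (q.1 0 k) - y 0 k| < q.2.+1%:R^-1) -> U y].
pose B (q : 'rV[rat]_d * nat) : set X :=
  \bigcap_(k in [set: 'I_d]) ((fun x => h x 0 k) @^-1` ball (ratr (q.1 0 k) : R) q.2.+1%:R^-1).
have -> : h @^-1` U = \bigcup_(q in D) B q.
  apply/seteqP; split=> [x Ux|x [q Dq Bq]]; last first.
    by apply: Dq => k; exact: (Bq k).
  have [e e0 he] := open_ballP oU Ux.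
  have [n hn] : exists n : nat, n.+1%:R^-1 < e / 2.
    have e20 : 0 < e / 2 by rewrite divr_gt0.
    exists (Num.truncn ((e / 2)^-1)).
    by rewrite invf_plt ?posrE ?ltr0n// truncnS_gt.
  have hq : forall k, exists q : rat, `|ratr q - h x 0 k| < n.+1%:R^-1.
    move=> k.
    have [|q] := @rat_in_itvoo R (h x 0 k - n.+1%:R^-1) (h x 0 k + n.+1%:R^-1).
      by rewrite ltrBlDr -addrA ltrDl addr_gt0// invr_gt0 ltr0n.
    by rewrite in_itv /= => hq; exists q; rewrite ltr_distl.
  have [q qP] := choice hq.
  exists (\row_k q k, n) => /=.
    move=> y hy; apply: he => k.
    have := hy k; have := qP k; rewrite /= mxE; set e' := _^-1 in hn * => h1 h2.
    have -> : h x 0 k - y 0 k = (ratr (q k) - y 0 k) - (ratr (q k) - h x 0 k) by ring.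
    by apply: le_lt_trans (ler_normB _ _) _; lra.
  by move=> k _ /=; rewrite /ball /= mxE; exact: qP.
rewrite bigcup_mkcond; apply: countable_bigcupT_measurable => [|q].
  exact: countableP.
case: ifP => // _; apply: fin_bigcap_measurable => // k _.
rewrite -[X in measurable X]setTI; apply: mh => //.
exact: open_measurable (ball_open _ _).
Qed.

Lemma borel_fun_indic_open d (U : set 'rV[R]_d) : open U -> borel_fun (\1_U : 'rV[R]_d -> R).
Proof.
move=> oU disp X h mh.
have -> : (fun x => \1_U (h x)) = \1_(h @^-1` U) :> (X -> R).
  by apply/funext => x; rewrite !indicE.
by apply: measurable_indic; exact: measurable_preimage_open.
Qed.

Lemma borel_fun_indic_closed d (U : set 'rV[R]_d) : closed U -> borel_fun (\1_U : 'rV[R]_d -> R).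
Proof.
move=> cU disp X h mh.
have -> : (fun x => \1_U (h x)) = \1_(h @^-1` U) :> (X -> R).
  by apply/funext => x; rewrite !indicE.
apply: measurable_indic.
rewrite -[h @^-1` U]setCK; apply: measurableC.
rewrite preimage_setC; apply: measurable_preimage_open => //.
exact: closed_openC.
Qed.

Lemma borel_fun_continuous d (f : 'rV[R]_d -> R) : continuous f -> borel_fun f.
Proof.
move=> cf disp X h mh.
move=> mT; apply: (measurability _ (RGenOpens.measurableE R)) mT.
move=> _ [_ [a [b ->]] <-]; rewrite setTI.
rewrite [X in measurable X](_ : _ = h @^-1` (f @^-1` `]a, b[)) //.
apply: measurable_preimage_open => //.
by move/continuousP: cf; apply; exact: interval_open.
Qed.

End Measurability.

(** * Iterated integrals *)

Section IteratedIntegral.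
Variable R : realType.
Local Notation mu := (@lebesgue_measure R).

Definition bounded_by (d : nat) (r M : R) (f : 'rV[R]_d -> R) : Prop :=
  (forall x, `|f x| <= M) /\ (forall (x : 'rV[R]_d) k, r < `|x 0 k| -> f x = 0).

(** A class stable under slicing whose members are integrable at every level of [iint]; linearity
    and monotonicity of [iint] then follow by induction on the dimension. *)
Definition nice (d : nat) (f : 'rV[R]_d -> R) : Prop :=
  borel_fun f /\ exists r M, 0 <= r /\ bounded_by r M f.

Local Notation slice f t := (fun y => f (row_mx (const_mx t : 'rV[R]_1) y)).

Lemma integrable_bounded_support (g : R -> R) (r M : R) :
  measurable_fun setT g -> (forall t, `|g t| <= M) ->
  (forall t, r < `|t| -> g t = 0) -> mu.-integrable setT (EFin \o g).
Proof.
move=> mg gM g0.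
have -> : g = g \_ `[- r, r]%classic.
  apply/funext => t; rewrite patchE; case: ifPn => // tr.
  apply: g0; rewrite ltNge; apply: contra tr => tr.
  by rewrite inE /= in_itv /= -ler_norml.
rewrite -restrict_EFin; apply: (integrable_mkcond _ _).1 => //.
apply: measurable_bounded_integrable => //.
- by rewrite /= lebesgue_measure_itv /=; case: ifP => _; rewrite ltry.
- exact: measurable_funTS.
- exists M; split; first exact: num_real.
  by move=> y My t _ /=; exact: le_trans (gM t) (ltW My).
Qed.

Lemma Rintegral_indic_itv (a b : R) : a <= b ->
  \int[mu]_t (\1_(`[a, b]%classic) t) = b - a.
Proof.
move=> ab; rewrite /Rintegral integral_indic //.
rewrite setIT /= lebesgue_measure_itv /= lte_fin.
by case: ltgtP ab => // -> _; rewrite subrr.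
Qed.

Lemma normr_Rintegral_le (g : R -> R) (r M : R) : 0 <= r ->
  measurable_fun setT g -> (forall t, `|g t| <= M) ->
  (forall t, r < `|t| -> g t = 0) -> `|\int[mu]_t g t| <= M * (2 * r).
Proof.
move=> r0 mg gM g0.
have ig := integrable_bounded_support mg gM g0.
have i1 : mu.-integrable setT (EFin \o (\1_(`[- r, r]%classic) : R -> R)).
  apply: (@integrable_bounded_support _ r 1) => [||t rt].
  - exact: measurable_indic.
  - by move=> t; rewrite indicE normr_nat lern1 leq_b1.
  - by rewrite indicE memNset//= in_itv /= -ler_norml leNgt rt.
apply: le_trans (le_normr_Rintegral measurableT ig) _.
apply: (@le_trans _ _ (\int[mu]_t (M * \1_(`[- r, r]%classic) t))).
  apply: le_Rintegral => //.
  - exact: integrable_norm.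
  - by have := integrableZl measurableT M i1; rewrite /comp.
  - move=> t _; rewrite indicE; case: (leP `|t| r) => tr.
      by rewrite mem_set ?mulr1//= in_itv /= -ler_norml.
    by rewrite g0// normr0 memNset ?mulr0//= in_itv /= -ler_norml leNgt tr.
rewrite RintegralZl// Rintegral_indic_itv; last lra.
by rewrite opprK mulr_natl mulr2n.
Qed.

Lemma bounded_by_slice (d : nat) (f : 'rV[R]_d.+1 -> R) r M t :
  bounded_by r M f -> @bounded_by d r M (slice f t).
Proof.
move=> [fM f0]; split=> [x|x k rk]; first exact: fM.
by apply: (f0 _ (rshift 1 k)); rewrite (@row_mxEr _ _ 1 d).
Qed.

(** Stated with the bound 0 so that the general estimate of [iint] also shows that the inner
    integral vanishes for [t] outside the support. *)
Lemma bounded_by_slice0 (d : nat) (f : 'rV[R]_d.+1 -> R) r M t : r < `|t| ->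
  bounded_by r M f -> @bounded_by d r 0 (slice f t).
Proof.
move=> rt [fM f0].
have s0 y : slice f t y = 0.
  by apply: (f0 _ (@lshift 1 d ord0)); rewrite (@row_mxEl _ _ 1 d) mxE.
by split=> [x|x k rk]; rewrite s0 ?normr0.
Qed.

Lemma measurable_iint_slice (d : nat) (f : 'rV[R]_d.+1 -> R) : borel_fun f ->
  measurable_fun setT (fun t : measurableTypeR R => iint (slice f t)).
Proof. by move=> mf; apply: measurable_iint; exact: borel_family_slice. Qed.

Lemma normr_iint_le (d : nat) (f : 'rV[R]_d -> R) r M : 0 <= r ->
  borel_fun f -> bounded_by r M f -> `|iint f| <= M * (2 * r) ^+ d.
Proof.
move=> r0; elim: d f M => [|d IH] f M mf fM /=.
  by rewrite expr0 mulr1; exact: fM.1.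
rewrite exprSr [leRHS]mulrA; apply: (@normr_Rintegral_le _ r (M * (2 * r) ^+ d)) => //.
- exact: measurable_iint_slice.
- by move=> t; apply: IH (bounded_by_slice t fM); exact: borel_fun_slice.
- move=> t rt; apply/eqP; rewrite -normr_le0.
  rewrite -[leRHS](mul0r ((2 * r) ^+ d)).
  by apply: IH (bounded_by_slice0 rt fM); exact: borel_fun_slice.
Qed.

Lemma nice_slice (d : nat) (f : 'rV[R]_d.+1 -> R) t : nice f -> @nice d (slice f t).
Proof.
move=> [mf [r [M [r0 fM]]]]; split; first exact: borel_fun_slice.
by exists r, M; split=> //; exact: bounded_by_slice.
Qed.

Lemma nice_integrable (d : nat) (f : 'rV[R]_d.+1 -> R) : nice f ->
  mu.-integrable setT (EFin \o (fun t => iint (slice f t))).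
Proof.
move=> [mf [r [M [r0 fM]]]].
apply: (@integrable_bounded_support _ r (M * (2 * r) ^+ d)).
- exact: measurable_iint_slice.
- by move=> t; apply: normr_iint_le (bounded_by_slice t fM) => //; exact: borel_fun_slice.
- move=> t rt; apply/eqP; rewrite -normr_le0 -[leRHS](mul0r ((2 * r) ^+ d)).
  by apply: normr_iint_le (bounded_by_slice0 rt fM) => //; exact: borel_fun_slice.
Qed.

Lemma eq_iint (d : nat) (f g : 'rV[R]_d -> R) : f =1 g -> iint f = iint g.
Proof. by move/funext ->. Qed.

Lemma iintD (d : nat) (f g : 'rV[R]_d -> R) : nice f -> nice g ->
  iint (fun x => f x + g x) = iint f + iint g.
Proof.
elim: d f g => [//|d IH] f g nf ng /=.
under eq_Rintegral do rewrite (IH _ _ (nice_slice _ nf) (nice_slice _ ng)).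
by apply: RintegralD => //; exact: nice_integrable.
Qed.

Lemma iintZ (d : nat) (c : R) (f : 'rV[R]_d -> R) : nice f ->
  iint (fun x => c * f x) = c * iint f.
Proof.
elim: d f => [//|d IH] f nf /=.
under eq_Rintegral do rewrite (IH _ (nice_slice _ nf)).
by apply: RintegralZl => //; exact: nice_integrable.
Qed.

Lemma le_iint (d : nat) (f g : 'rV[R]_d -> R) : nice f -> nice g ->
  (forall x, f x <= g x) -> iint f <= iint g.
Proof.
elim: d f g => [|d IH] f g nf ng fg /=; first exact: fg.
apply: le_Rintegral => //; [exact: nice_integrable..|move=> t _].
by apply: IH => //; exact: nice_slice.
Qed.

Lemma niceD (d : nat) (f g : 'rV[R]_d -> R) : nice f -> nice g ->
  nice (fun x => f x + g x).
Proof.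
move=> [mf [r [M [r0 [fM f0]]]]] [mg [r' [M' [r'0 [gM g0]]]]].
split; first exact: borel_funD.
exists (r + r'), (M + M'); split; first lra.
split=> [x|x k rk]; first by apply: le_trans (ler_normD _ _) _; exact: lerD.
by rewrite (f0 x k) ?(g0 x k) ?addr0//; lra.
Qed.

Lemma niceM (d : nat) (f g : 'rV[R]_d -> R) M' : nice f -> borel_fun g ->
  (forall x, `|g x| <= M') -> nice (fun x => g x * f x).
Proof.
move=> [mf [r [M [r0 [fM f0]]]]] mg gM.
split; first exact: borel_funM.
exists r, (M' * M); split=> //; split=> [x|x k rk].
  by rewrite normrM; exact: ler_pM.
by rewrite (f0 x k) ?mulr0.
Qed.

Lemma niceZ (d : nat) (c : R) (f : 'rV[R]_d -> R) : nice f -> nice (fun x => c * f x).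
Proof. by move=> nf; apply: (niceM (M' := `|c|)) => //; exact: borel_fun_cst. Qed.

Lemma nice0 (d : nat) : nice (fun _ : 'rV[R]_d => 0).
Proof.
split; first exact: borel_fun_cst.
by exists 0, 0; split=> //; split=> // x; rewrite normr0.
Qed.

Lemma nice_sum (d : nat) (I : Type) (s : seq I) (F : I -> 'rV[R]_d -> R) :
  (forall i, nice (F i)) -> nice (fun x => \sum_(i <- s) F i x).
Proof.
move=> nF; elim: s => [|i s IH].
  by under eq_fun do rewrite big_nil; exact: nice0.
by under eq_fun do rewrite big_cons; exact: niceD (nF i) IH.
Qed.

Lemma iint0 (d : nat) : iint (fun _ : 'rV[R]_d => 0) = 0.
Proof.
rewrite -[RHS](mul0r (iint (fun _ : 'rV[R]_d => 0))) -(iintZ 0 (nice0 d)).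
by apply: eq_iint => x; rewrite mul0r.
Qed.

Lemma iint_sum (d : nat) (I : Type) (s : seq I) (F : I -> 'rV[R]_d -> R) :
  (forall i, nice (F i)) ->
  iint (fun x => \sum_(i <- s) F i x) = \sum_(i <- s) iint (F i).
Proof.
move=> nF; elim: s => [|i s IH].
  by rewrite big_nil -[RHS](iint0 d); apply: eq_iint => x; rewrite big_nil.
rewrite big_cons -IH -iintD //; last exact: nice_sum.
by apply: eq_iint => x; rewrite big_cons.
Qed.

(** * Cubes and their volume *)

Definition box (d : nat) (a : 'rV[R]_d) (s : R) : set 'rV[R]_d :=
  [set x | forall k, a 0 k <= x 0 k <= a 0 k + s].

Lemma nice_box (d : nat) (a : 'rV[R]_d) (s : R) : nice (\1_(box a s) : _ -> R).
Proof.
split.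
  move=> disp X h mh.
  have -> : (fun x => \1_(box a s) (h x)) = \1_(h @^-1` box a s) :> (X -> R).
    by apply/funext => x; rewrite !indicE.
  apply: measurable_indic.
  have -> : h @^-1` box a s = \bigcap_(k in [set: 'I_d])
      ((fun x => h x 0 k) @^-1` `[a 0 k, a 0 k + s]).
    by apply/seteqP; split=> x /= H k; [move=> _|]; have := H k; rewrite /= in_itv //=; apply.
  apply: fin_bigcap_measurable => // k _.
  by rewrite -[X in measurable X]setTI; apply: mh => //; exact: measurable_itv.
(* The sum over all coordinates dominates each [|a k| + |s|]; the absolute value of [s] appears
   because its sign is arbitrary. *)
exists (\sum_k (`|a 0 k| + `|s|)), 1; split.
  by apply: sumr_ge0 => k _; rewrite addr_ge0.
split=> [x|x k hk]; first by rewrite indicE normr_nat lern1 leq_b1.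
rewrite indicE memNset //= => /(_ k) /andP[h1 h2].
move: hk; rewrite (bigD1 k) //= ltNge => /negP; apply.
apply: ler_wpDr; first by apply: sumr_ge0 => j _; rewrite addr_ge0.
rewrite ler_norml; apply/andP; split.
  by have := ler_norm (- a 0 k); rewrite normrN; have := normr_ge0 s; lra.
by have := ler_norm (a 0 k); have := ler_norm s; lra.
Qed.

(** The indicator of a cube factors into that of an interval in the first coordinate and that of a
    cube of one dimension less. In dimension 0 the box is the single point and the value is
    [s ^+ 0 = 1]. *)
Lemma iint_box (d : nat) (a : 'rV[R]_d) (s : R) : 0 <= s ->
  iint (\1_(box a s)) = s ^+ d.
Proof.
move=> s0; elim: d a => [|d IH] a /=.
  by rewrite indicE mem_set //= => -[].
pose a0 := @lsubmx R 1 1 d a 0 0; pose a' := @rsubmx R 1 1 d a.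
have E t y : \1_(box a s) (row_mx (const_mx t : 'rV[R]_1) y) =
    \1_(`[a0, a0 + s]%classic) t * \1_(box a' s) y :> R.
  rewrite !indicE -natrM mulnb; congr (_%:R); congr nat_of_bool.
  apply/idP/andP.
    rewrite !inE => H; split.
      by have := H (@lshift 1 d ord0); rewrite /= in_itv /= (@row_mxEl _ _ 1 d) /a0 !mxE.
    by move=> k; have := H (rshift 1 k); rewrite (@row_mxEr _ _ 1 d) /a' !mxE.
  rewrite !inE /= in_itv /= => -[H1 H2] k.
  case: (@split_ordP 1 d k) => j ->.
    by rewrite (@row_mxEl _ _ 1 d) ord1 mxE; rewrite /a0 !mxE in H1.
  by rewrite (@row_mxEr _ _ 1 d); have := H2 j; rewrite /a' !mxE.
have E2 t : iint (slice (\1_(box a s)) t) = s ^+ d * \1_(`[a0, a0 + s]%classic) t.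
  by rewrite (eq_iint (E t)) iintZ; [rewrite IH mulrC|exact: nice_box].
under eq_Rintegral do rewrite E2.
rewrite RintegralZl //.
  by rewrite Rintegral_indic_itv ?lerDl// addrAC subrr add0r exprSr.
apply: (@integrable_bounded_support _ (`|a0| + s) 1).
- exact: measurable_indic.
- by move=> t; rewrite indicE normr_nat lern1 leq_b1.
- move=> t ht; rewrite indicE memNset //= in_itv /= => /andP[h1 h2].
  move: ht; rewrite ltNge => /negP; apply; rewrite ler_norml; apply/andP; split.
    by have := ler_norm (- a0); rewrite normrN; lra.
  by have := ler_norm a0; lra.
Qed.

(* Sets invisible to [iint]: only finitely many slices in the first coordinate may be
   arbitrary.  Borel measurability of the integrands survives changes on such sets. *)
Fixpoint exceptional (d : nat) : set 'rV[R]_d -> Prop :=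
  match d return set 'rV[R]_d -> Prop with
  | 0 => fun N => ~ N 0
  | d'.+1 => fun N => exists F : seq R, forall t, t \notin F ->
      @exceptional d' [set y | N (row_mx (const_mx t : 'rV[R]_1) y)]
  end.

Lemma exceptionalU (d : nat) (N N' : set 'rV[R]_d) :
  exceptional N -> exceptional N' -> exceptional (N `|` N').
Proof.
elim: d N N' => [|d IH] N N' /=; first by move=> h1 h2 [].
move=> [F hF] [F' hF']; exists (F ++ F') => t.
rewrite mem_cat negb_or => /andP[tF tF'].
by apply: (IH _ _ (hF t tF) (hF' t tF')).
Qed.

Lemma exceptional0 (d : nat) : exceptional (set0 : set 'rV[R]_d).
Proof. by elim: d => [|d IH] //=; exists [::]. Qed.

(** The slice at [t] is the zero set of [(b + w0 * t) + edot w' y], again a nontrivial affine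
    function unless [w' = 0] and [b + w0 * t = 0]. Excluding [t = - b / w0] suffices; if [w0 = 0]
    this excluded value is 0 by the division convention, and a trivial slice would force [b = 0] and
    [w = 0]. *)
Lemma exceptional_hyperplane (d : nat) (b : R) (w : 'rV[R]_d) :
  (b != 0) || (w != 0) -> exceptional [set x | b + edot w x = 0].
Proof.
elim: d b w => [|d IH] b w /=.
  rewrite [w]thinmx0 eqxx orbF /edot big_ord0 addr0.
  by move/eqP.
pose w0 := @lsubmx R 1 1 d w 0 0; pose w' := @rsubmx R 1 1 d w.
have E t y : edot w (row_mx (const_mx t : 'rV[R]_1) y) = w0 * t + edot w' y.
  rewrite /edot big_ord_recl; congr (_ + _).
    have -> : ord0 = @lshift 1 d ord0 by exact/val_inj.
    by rewrite (@row_mxEl _ _ 1 d) /w0 !mxE.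
  apply: eq_bigr => k _.
  have -> : lift ord0 k = @rshift 1 d k by exact/val_inj.
  by rewrite (@row_mxEr _ _ 1 d) /w' mxE.
move=> hbw; exists [:: - b / w0] => t; rewrite inE => ht.
have -> : [set y | b + edot w (row_mx (const_mx t : 'rV[R]_1) y) = 0] =
    [set y | (b + w0 * t) + edot w' y = 0].
  by apply/seteqP; split=> y /=; rewrite E addrA.
apply: IH; apply: contraTT hbw; rewrite !negb_or !negbK => /andP[/eqP h1 /eqP h2].
have w00 : w0 = 0.
  apply/eqP; apply: contraNT ht => w00; apply/eqP.
  by apply: (mulIf w00); rewrite divfK// mulrC; apply/eqP; rewrite -addr_eq0 addrC h1.
have b0 : b = 0 by move: h1; rewrite w00 mul0r addr0.
rewrite b0 eqxx /=; apply/eqP; rewrite -(@hsubmxK _ 1 1 d w) -/w' h2.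
have -> : @lsubmx R 1 1 d w = 0.
  by apply/matrixP => i j; rewrite !ord1 [RHS]mxE -w00.
exact: (@row_mx0 R 1 1 d).
Qed.

Lemma eq_Rintegral_finite (f g : R -> R) (F : seq R) : measurable_fun setT g ->
  (forall t, t \notin F -> f t = g t) -> \int[mu]_t f t = \int[mu]_t g t.
Proof.
move=> mg fg.
have mf : measurable_fun setT f.
  (* Measurability of [f] is inherited from [g]: [f] is [g] corrected at finitely many points, each
     counted once thanks to [undup]. *)
  have -> : f = fun t => g t + \sum_(a <- undup F) (f a - g a) * \1_[set a] t.
    apply/funext => t; case: (boolP (t \in F)) => tF; last first.
      rewrite fg// big1_seq ?addr0// => a /=; rewrite mem_undup => aF.
      by rewrite indicE memNset ?mulr0//= => ta; move: tF; rewrite ta aF.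
    rewrite (bigD1_seq t) ?mem_undup ?undup_uniq//= indicE mem_set// mulr1.
    rewrite big1 ?addr0; first by ring.
    by move=> a /eqP at_; rewrite indicE memNset ?mulr0//= => ta; apply: at_.
  apply: measurable_funD => //; apply: measurable_sum => a.
  by apply: measurable_funM => //; exact: measurable_indic.
rewrite /Rintegral; congr fine; apply: ae_eq_integral => //.
- exact/measurable_EFinP.
- exact/measurable_EFinP.
exists [set` F]; split.
- apply: countable_measurable; first by move=> t; exact: measurable_set1.
  by apply: finite_set_countable; exact: finite_seq.
- by apply: countable_lebesgue_measure0; apply: finite_set_countable; exact: finite_seq.
- move=> t /=; apply: contra_notP => /negP tF _.
  by rewrite fg.
Qed.

(** By induction the inner integrals agree on all but finitely many slices. Regularity is asked of
    [g] only, so [f] may be an integrand containing derivatives about which nothing is known on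
    [N]. *)
Lemma eq_iint_exceptional (d : nat) (f g : 'rV[R]_d -> R) (N : set 'rV[R]_d) :
  exceptional N -> borel_fun g -> (forall x, ~ N x -> f x = g x) -> iint f = iint g.
Proof.
elim: d f g N => [|d IH] f g N /=; first by move=> N0 _; apply.
move=> [F hF] mg fg; apply: (@eq_Rintegral_finite _ _ F).
  exact: measurable_iint_slice.
move=> t tF; apply: IH (hF t tF) _ _; first exact: borel_fun_slice.
by move=> y /= Ny; apply: fg.
Qed.

End IteratedIntegral.

(** * Simplices and barycentric coordinates *)

Section Euclid.
Variables (R : realType) (d : nat).
Local Notation pt := 'rV[R]_d.

Lemma edotC (x y : pt) : edot x y = edot y x.
Proof. by apply: eq_bigr => k _; rewrite mulrC. Qed.

Lemma edotDr (w x y : pt) : edot w (x + y) = edot w x + edot w y.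
Proof. by rewrite -big_split; apply: eq_bigr => k _; rewrite mxE mulrDr. Qed.

Lemma edotZr (w x : pt) a : edot w (a *: x) = a * edot w x.
Proof. by rewrite /edot mulr_sumr; apply: eq_bigr => k _; rewrite mxE mulrCA. Qed.

Lemma edotBr (w x y : pt) : edot w (x - y) = edot w x - edot w y.
Proof. by rewrite -scaleN1r edotDr edotZr mulN1r. Qed.

Lemma edot_sumr (w : pt) (I : finType) (F : I -> pt) :
  edot w (\sum_i F i) = \sum_i edot w (F i).
Proof.
rewrite /edot exchange_big /=; apply: eq_bigr => k _.
by rewrite summxE mulr_sumr.
Qed.

Lemma edot0l (x : pt) : edot 0 x = 0.
Proof. by rewrite /edot big1// => k _; rewrite mxE mul0r. Qed.

Lemma edot_delta (w : pt) k : edot w (delta_mx 0 k) = w 0 k.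
Proof.
rewrite /edot (bigD1 k) //= mxE !eqxx mulr1 big1 ?addr0 // => j jk.
by rewrite mxE eqxx /= (negbTE jk) mulr0.
Qed.

Lemma normr_edot_le (w x : pt) e : (forall k, `|x 0 k| <= e) ->
  `|edot w x| <= (\sum_k `|w 0 k|) * e.
Proof.
move=> xe; rewrite mulr_suml; apply: le_trans (ler_norm_sum _ _ _) _.
by apply: ler_sum => k _; rewrite normrM ler_wpM2l.
Qed.

Lemma affine_comb (I : finType) (l : I -> R) (s : I -> pt) b (w : pt) :
  \sum_i l i = 1 ->
  b + edot w (\sum_i l i *: s i) = \sum_i l i * (b + edot w (s i)).
Proof.
move=> l1; rewrite edot_sumr -[b in LHS]mul1r -l1 mulr_suml -big_split /=.
by apply: eq_bigr => i _; rewrite edotZr mulrDr.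
Qed.

Lemma normr_coord_le_enorm (x : pt) k : `|x 0 k| <= enorm x.
Proof.
rewrite -sqrtr_sqr /enorm ler_wsqrtr// /edot (bigD1 k) //= expr2 lerDl.
by apply: sumr_ge0 => j _; rewrite -expr2 sqr_ge0.
Qed.

Lemma enorm_le_sum (x : pt) : enorm x <= \sum_k `|x 0 k|.
Proof.
have s0 : 0 <= \sum_k `|x 0 k| by apply: sumr_ge0.
rewrite -[leRHS]ger0_norm// -sqrtr_sqr ler_wsqrtr// expr2 mulr_suml /edot.
apply: ler_sum => k _; rewrite -expr2 -real_normK ?num_real// expr2 ler_wpM2l//.
by rewrite (bigD1 k) //= lerDl; apply: sumr_ge0.
Qed.

Lemma continuous_affine b (w : pt) : continuous (fun x => b + edot w x).
Proof.
move=> x A /nbhs_ballP[e /= e0 eA].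
pose S := \sum_k `|w 0 k|; have S0 : 0 <= S by exact: sumr_ge0.
(* The summand 1 keeps the divisor positive when [w] vanishes. *)
have S1 : 0 < 1 + S by lra.
suff : nbhs x ((fun x => b + edot w x) @^-1` A) by [].
apply/nbhs_ballP; exists (e / (1 + S)) => /=; first by rewrite divr_gt0.
move=> y /(mx_ballE x y (divr_gt0 e0 S1)) hy; apply: eA; rewrite /ball /=.
rewrite opprD addrACA subrr add0r -edotBr.
apply: le_lt_trans (normr_edot_le w (e := e / (1 + S)) _) _.
  by move=> k; rewrite !mxE ltW.
by rewrite -/S mulrA ltr_pdivrMr// mulrC ltr_pM2l//; lra.
Qed.

End Euclid.

Section Simplex.
Variables (R : realType) (d : nat) (T : simplex R d).
Local Notation pt := 'rV[R]_d.

Definition vertex_mx : 'M[R]_(1 + d) := \matrix_(k < d.+1) row_mx (const_mx 1 : 'rV[R]_1) (T k).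

(** Barycentric coordinates: the solution [l] of [l *m vertex_mx = (1, x)], where the column of ones
    encodes that the coordinates sum to 1. They are affine functions on the whole space. *)
Definition bary (x : pt) (k : 'I_d.+1) : R :=
  (row_mx (const_mx 1 : 'rV[R]_1) x *m invmx vertex_mx) 0 k.

Lemma mul_vertex_mx (v : 'rV[R]_d.+1) :
  v *m (vertex_mx : 'M[R]_(d.+1, 1 + d)) =
  row_mx (const_mx (\sum_k v 0 k)) (\sum_k v 0 k *: T k).
Proof.
rewrite mulmx_sum_row.
under eq_bigr do rewrite rowK scale_row_mx.
apply/rowP => j; rewrite summxE; case: (@split_ordP 1 d j) => i ->.
  under eq_bigr do rewrite (@row_mxEl _ _ 1 d).
  rewrite (@row_mxEl _ _ 1 d) mxE; apply: eq_bigr => k _; by rewrite !mxE mulr1.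
under eq_bigr do rewrite (@row_mxEr _ _ 1 d).
by rewrite (@row_mxEr _ _ 1 d) summxE.
Qed.

Hypothesis ndT : Defs.nondegenerate T.

(** A left null vector has coefficients of sum 0 that annihilate the vertices. Subtracting [T ord0]
    from every vertex turns it into a null vector of the invertible edge matrix, so all coefficients
    but the first vanish, and then the first does by the sum condition. *)
Lemma vertex_mx_unit : vertex_mx \in unitmx.
Proof.
rewrite -row_free_unit; apply: inj_row_free => v.
rewrite mul_vertex_mx -(@row_mx0 R 1 1 d) => /eq_row_mx[/matrixP/(_ 0 0)].
rewrite !mxE => s0 v0.
pose D := \matrix_(i < d, k < d) (T (lift ord0 i) 0 k - T ord0 0 k).
have uD : D \in unitmx by rewrite unitmxE unitfE.
pose v' := \row_i v 0 (lift ord0 i) : 'rV[R]_d.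
have v'0 : v' = 0.
  apply: (can_inj (mulmxK uD)); rewrite mul0mx; apply/rowP => j; rewrite !mxE.
  transitivity (\sum_k v 0 k * (T k 0 j - T ord0 0 j)).
    rewrite [RHS]big_ord_recl subrr mulr0 add0r.
    by apply: eq_bigr => i _; rewrite !mxE.
  under eq_bigr do rewrite mulrBr.
  rewrite sumrB -mulr_suml s0 mul0r subr0.
  move/rowP/(_ j): v0; rewrite summxE mxE => v0j.
  rewrite -[RHS]v0j.
  by apply: eq_bigr => k _; rewrite mxE.
have vl i : v 0 (lift ord0 i) = 0 by move/rowP/(_ i): v'0; rewrite !mxE.
rewrite (@row_mx0 R 1 1 d); apply/rowP => k; rewrite [RHS]mxE.
case: (unliftP ord0 k) => [i ->|->]; first exact: vl.
by move: s0; rewrite big_ord_recl big1 ?addr0.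
Qed.

Lemma bary_mul x : (\row_k bary x k) *m (vertex_mx : 'M[R]_(d.+1, 1 + d)) =
  row_mx (const_mx 1 : 'rV[R]_1) x.
Proof.
have -> : \row_k bary x k = row_mx (const_mx 1 : 'rV[R]_1) x *m invmx vertex_mx.
  by apply/rowP => k; rewrite mxE.
exact: (mulmxKV vertex_mx_unit).
Qed.

Lemma sum_bary x : \sum_k bary x k = 1.
Proof.
have := bary_mul x; rewrite mul_vertex_mx => /eq_row_mx[/matrixP/(_ 0 0)].
by rewrite !mxE => <- _; apply: eq_bigr => k _; rewrite mxE.
Qed.

Lemma bary_comb x : \sum_k bary x k *: T k = x.
Proof.
have := bary_mul x; rewrite mul_vertex_mx => /eq_row_mx[_ E].
by rewrite -[RHS]E; apply: eq_bigr => k _; rewrite mxE.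
Qed.

Lemma bary_vertex l k : bary (T l) k = (k == l)%:R.
Proof.
rewrite /bary.
have -> : row_mx (const_mx 1 : 'rV[R]_1) (T l) = row l (vertex_mx : 'M[R]_(d.+1, 1 + d)).
  by rewrite rowK.
rewrite -row_mul (mulmxV vertex_mx_unit).
by rewrite mxE mxE eq_sym.
Qed.

Lemma bary_affine k : exists b (w : pt), forall x, bary x k = b + edot w x.
Proof.
pose B := invmx vertex_mx.
exists (@usubmx R 1 d (1 + d) B 0 k), (\row_j @dsubmx R 1 d (1 + d) B j k) => x.
rewrite /bary -/B -[B in LHS](@vsubmxK R 1 d (1 + d)) mul_row_col mxE; congr (_ + _).
  by rewrite mxE big_ord1 mxE mul1r.
by rewrite mxE /edot; apply: eq_bigr => j _; rewrite mxE mulrC.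
Qed.

Lemma codom_simplexP v : reflect (exists k, v = T k) (v \in codom T).
Proof. by apply: (iffP codomP) => -[k ->]; exists k. Qed.

Lemma size_codom_simplex : size (codom T) = d.+1.
Proof. by rewrite size_codom card_ord. Qed.

(** Each barycentric coordinate is affine and is 0 or 1 at the vertices, hence nonnegative on convex
    combinations; conversely the barycentric coordinates are themselves admissible weights. *)
Lemma hullP x : hull T x <-> forall k, 0 <= bary x k.
Proof.
split=> [[l [l0 [l1 ->]]] k|x0].
  have [b [w bw]] := bary_affine k; rewrite bw affine_comb //.
  apply: sumr_ge0 => i _; apply: mulr_ge0 => //.
  have /codom_simplexP[m ->] : (codom T)`_i \in codom T by rewrite mem_nth.
  by rewrite -bw bary_vertex ler0n.
(* [conv] indexes its weights by positions in the list [codom T]; [c] identifies these positions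
   with the vertex indices. *)
pose c := cast_ord size_codom_simplex.
have cb : {on [pred i | true], bijective c}.
  apply: onW_bij; exists (cast_ord (esym size_codom_simplex)).
    exact: cast_ordK.
  exact: cast_ordKV.
exists (fun i => bary x (c i)); split; first by move=> i; exact: x0.
split; first by rewrite -(sum_bary x) [RHS](reindex c).
rewrite -{1}(bary_comb x) (reindex c) //=; apply: eq_bigr => i _; congr (_ *: _).
have hi : (i < d.+1)%N by have := ltn_ord i; rewrite [X in (_ < X)%N -> _]size_codom_simplex.
rewrite /codom /image_mem (nth_map ord0) ?size_enum_ord//.
by have -> : c i = nth ord0 (enum 'I_d.+1) i by apply/val_inj; rewrite /= nth_enum_ord.
Qed.

Lemma hull_vertex k : hull T (T k).
Proof. by apply/hullP => l; rewrite bary_vertex ler0n. Qed.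

Lemma affine_on_hull (u : pt -> R) b (w : pt) x :
  (forall y, hull T y -> u y = b + edot w y) -> hull T x ->
  u x = \sum_k bary x k * u (T k).
Proof.
move=> uE hx; rewrite uE// -{1}(bary_comb x) affine_comb ?sum_bary//.
by apply: eq_bigr => k _; rewrite uE//; exact: hull_vertex.
Qed.

(** The coordinate of index [k] is affine and vanishes at every vertex other than [T k], hence on
    the hull of any family of those. This is how simplices sharing an interior point are shown to
    share vertices. *)
Lemma conv_missing_vertex (s : seq pt) x k :
  (forall v, v \in s -> v \in codom T) -> T k \notin s -> Defs.conv s x -> bary x k = 0.
Proof.
move=> sT ks [l [l0 [l1 ->]]].
have [b [w bw]] := bary_affine k; rewrite bw affine_comb // big1 // => i _.
have si : s`_i \in s by rewrite mem_nth.
have /codom_simplexP[m Em] := sT _ si.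
rewrite -bw Em bary_vertex; case: eqP => [km|]; last by rewrite mulr0.
by move: ks; rewrite km -Em si.
Qed.

Lemma bary_gt0_nbhs (x : pt) : (forall k, 0 < bary x k) ->
  exists2 e : R, 0 < e & forall y : pt, (forall k, `|x 0 k - y 0 k| < e) ->
    forall k, 0 < bary y k.
Proof.
move=> x0.
have : \forall y \near x, forall k, 0 < bary y k.
  apply: (filter_forall (nbhs_filter x)) => k; have [b [w bw]] := bary_affine k.
  have := @continuous_affine R d b w x => /(_ [set r | 0 < r]) /=.
  have := x0 k; rewrite bw => bk /(_ (lt_nbhsr bk)).
  by apply: (@filterS _ _ (nbhs_filter x)) => y /=; rewrite bw.
move=> /nbhs_ballP[e /= e0 he]; exists e => // y hy k.
by apply: he; apply/mx_ballE.
Qed.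

(** Moving from [x] away from [T k] by a factor [eps] stays in the simplex and turns the coordinate
    into [(1 + eps) * bary x k - eps]. Its nonnegativity forces [bary x k] to be positive. *)
Lemma nbhs_bary_gt0 (x : pt) (e : R) : 0 < e ->
  (forall y : pt, (forall k, `|x 0 k - y 0 k| <= e) -> hull T y) ->
  forall k, 0 < bary x k.
Proof.
move=> e0 he k.
(* Normalises the step: with [eps = e / S] no coordinate moves by more than [e]. *)
pose S := 1 + \sum_j `|T k 0 j - x 0 j|.
have S0 : 0 < S by rewrite ltr_pwDl// sumr_ge0.
pose eps := e / S; have eps0 : 0 < eps by rewrite divr_gt0.
have /hullP/(_ k) : hull T (x + eps *: (x - T k)).
  apply: he => j; rewrite !mxE opprD addNKr normrN normrM gtr0_norm// distrC.
  rewrite /eps mulrAC ler_pdivrMr// ler_wpM2l ?(ltW e0)// /S (bigD1 j) //=.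
  by have : 0 <= \sum_(i | i != j) `|T k 0 i - x 0 i|; [exact: sumr_ge0|lra].
have [b [w bw]] := bary_affine k.
have := bary_vertex k k; rewrite !bw eqxx edotDr edotZr edotBr /= => vk.
have -> : b + (edot w x + eps * (edot w x - edot w (T k))) =
  (1 + eps) * (b + edot w x) - eps * (b + edot w (T k)) by ring.
rewrite vk mulr1 subr_ge0 => h.
have : 0 < (1 + eps) * (b + edot w x) by exact: lt_le_trans h.
by rewrite pmulr_rgt0//; lra.
Qed.

Lemma diam_ge k l : enorm (T k - T l) <= diam T.
Proof.
apply: le_trans (le_bigmax _ _ k).
exact: (le_bigmax _ (fun l => enorm (T k - T l)) l).
Qed.

Lemma hull_vertex_dist x k j : hull T x -> `|x 0 j - T k 0 j| <= diam T.
Proof.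
move/hullP => x0.
have -> : x 0 j - T k 0 j = \sum_l bary x l * (T l 0 j - T k 0 j).
  under eq_bigr do rewrite mulrBr.
  rewrite sumrB -mulr_suml sum_bary mul1r; congr (_ - _).
  by rewrite -{1}(bary_comb x) summxE; apply: eq_bigr => l _; rewrite mxE.
apply: le_trans (ler_norm_sum _ _ _) _.
rewrite -[leRHS]mul1r -(sum_bary x) mulr_suml; apply: ler_sum => l _.
rewrite normrM ger0_norm//; apply: ler_wpM2l => //.
apply: le_trans (diam_ge l k).
by have := normr_coord_le_enorm (T l - T k) j; rewrite !mxE.
Qed.

Lemma diam_gt0 : (0 < d)%N -> 0 < diam T.
Proof.
move=> d0; rewrite ltNge; apply/negP => D0.
(* Positive dimension provides a second vertex; diameter 0 would make it equal to the first. *)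
pose l : 'I_d.+1 := lift ord0 (Ordinal d0).
have E : T l = T ord0.
  apply/rowP => j; apply/eqP; rewrite -subr_eq0 -normr_le0.
  by apply: le_trans D0; exact: hull_vertex_dist (hull_vertex l).
have := bary_vertex ord0 ord0; rewrite -E bary_vertex /= => /eqP.
by rewrite eq_sym oner_eq0.
Qed.

Lemma normr_affine_on_hull (u : pt -> R) b (w : pt) x :
  (forall y, hull T y -> u y = b + edot w y) -> hull T x ->
  exists k, `|u x| <= `|u (T k)|.
Proof.
move=> uE hx.
pose k := [arg max_(k > ord0) `|u (T k)|]%O; exists k.
have km l : `|u (T l)| <= `|u (T k)|.
  by rewrite /k; case: arg_maxP => // i _; apply.
rewrite (affine_on_hull uE hx); apply: le_trans (ler_norm_sum _ _ _) _.
rewrite -[leRHS]mul1r -(sum_bary x) mulr_suml; apply: ler_sum => l _.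
by have /hullP/(_ l) b0 := hx; rewrite normrM ger0_norm//; apply: ler_wpM2l.
Qed.

Lemma closed_hull : closed (hull T).
Proof.
have -> : hull T = \bigcap_(k in [set: 'I_d.+1]) [set x | 0 <= bary x k].
  by apply/seteqP; split=> x; [move/hullP => h k _; exact: h|move=> h; apply/hullP => k; exact: h].
apply: closed_bigI => k _; have [b [w bw]] := bary_affine k.
have -> : [set x | 0 <= bary x k] = (fun x => b + edot w x) @^-1` [set r | 0 <= r].
  by apply/seteqP; split=> x /=; rewrite bw.
apply: closed_comp => [x _|]; first exact: continuous_affine.
exact: closed_ge.
Qed.

(** The affine function [bary] of index [k] equals 1 at [T k], so its coefficients are not all
    zero. *)
Lemma exceptional_facets (k : 'I_d.+1) : exceptional [set x | bary x k = 0].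
Proof.
have [b [w bw]] := bary_affine k.
have -> : [set x | bary x k = 0] = [set x | b + edot w x = 0].
  by apply/seteqP; split=> x /=; rewrite bw.
apply: exceptional_hyperplane; have := bary_vertex k k; rewrite bw eqxx.
apply: contra_eqT; rewrite negb_or !negbK => /andP[/eqP -> /eqP ->].
by rewrite add0r edot0l eq_sym oner_eq0.
Qed.

End Simplex.

(** * The mass matrix *)

Section Mesh.
Variables (R : realType) (d : nat) (Om : set 'rV[R]_d) (Ts : seq (simplex R d)).
Local Notation pt := 'rV[R]_d.
Hypothesis tri : triangulation Om Ts.

Let h := mesh_size Ts.

Lemma mesh_nondegenerate T : T \in Ts -> Defs.nondegenerate T.
Proof. exact: tri.1. Qed.

Lemma mesh_cover x : closure Om x <-> exists2 T, T \in Ts & hull T x.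
Proof.
rewrite (tri.2.1); split; first by move=> [T TTs Tx]; exists T.
by move=> [T TTs Tx]; exists T.
Qed.

Lemma diam_le_mesh T : T \in Ts -> diam T <= h.
Proof.
rewrite /h /mesh_size; elim: Ts => //= T' s IH.
rewrite in_cons big_cons le_max => /orP[/eqP ->|/IH ->]; first by rewrite lexx.
by rewrite orbT.
Qed.

Lemma vertex_dist T x k j : T \in Ts -> hull T x -> `|x 0 j - T k 0 j| <= h.
Proof.
move=> TTs Tx; apply: le_trans (diam_le_mesh TTs).
exact: hull_vertex_dist (mesh_nondegenerate TTs) _ _ _ Tx.
Qed.

Lemma mesh_gt0 T : (0 < d)%N -> T \in Ts -> 0 < h.
Proof.
move=> d0 TTs; apply: lt_le_trans (diam_le_mesh TTs).
exact: diam_gt0 (mesh_nondegenerate TTs) d0.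
Qed.

Lemma continuous_sum (n : nat) (f : 'I_n -> pt -> R) :
  (forall i, continuous (f i)) -> continuous (fun x => \sum_i f i x).
Proof.
move=> cf x.
have -> : (fun x => \sum_i f i x) = \sum_i f i.
  by apply/funext => y; rewrite fct_sumE.
elim/big_ind : _ => [|g1 g2 c1 c2|i _]; [|exact: continuousD|exact: cf].
exact: (@cst_continuous _ _ (0 : R) x).
Qed.

Lemma Vh_sum (n : nat) (a : 'I_n -> R) (f : 'I_n -> pt -> R) :
  (forall i, Vh Om Ts (f i)) -> Vh Om Ts (fun x => \sum_i a i * f i x).
Proof.
move=> fV; split.
  apply: continuous_sum => i x; apply: (@cvgMr _ _ _ (nbhs_filter x)).
  exact: (fV i).1.
split=> [x Omx|T TTs].
  by rewrite big1// => i _; rewrite (fV i).2.1 ?mulr0.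
have /choice[b hb] : forall i, exists b, exists w, forall x, hull T x -> f i x = b + edot w x.
  by move=> i; exact: (fV i).2.2 TTs.
have [w hw] := choice hb.
exists (\sum_i a i * b i), (\sum_i a i *: w i) => x Tx.
rewrite edotC edot_sumr -big_split; apply: eq_bigr => i _ /=.
by rewrite (hw i x Tx) edotZr (edotC x) mulrDr.
Qed.

(** A crude bound, serving only to show that finite element functions are bounded. *)
Lemma normr_Vh_le u x : Vh Om Ts u ->
  `|u x| <= \sum_(T <- Ts) \sum_k `|u (T k)|.
Proof.
move=> [_ [u0 uaff]].
have S0 (T : simplex R d) : 0 <= \sum_k `|u (T k)| by exact: sumr_ge0.
have [Omx|Omx] := pselect (Om x); last first.
  by rewrite u0// normr0; apply: sumr_ge0.
have [T TTs Tx] := (mesh_cover x).1 (subset_closure Omx).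
have [b [w ubw]] := uaff T TTs.
have [k uk] := normr_affine_on_hull (mesh_nondegenerate TTs) ubw Tx.
apply: (le_trans uk).
apply: (@le_trans _ _ (\sum_k `|u (T k)|)).
  by rewrite (bigD1 k)//= lerDl; exact: sumr_ge0.
rewrite (big_rem T)//= lerDl; exact: sumr_ge0.
Qed.

Hypothesis bOm : bounded_set Om.

Lemma bounded_coords : exists2 r : R, 0 < r & forall x k, Om x -> `|x 0 k| <= r.
Proof.
(* [bounded_set] bounds the norm only by numbers strictly above [M], hence the [+ 1]. The norm on
   row vectors is the maximum norm, so it controls each coordinate. *)
have [M [_ hM]] := bOm; exists (`|M| + 1); first by rewrite ltr_wpDl.
move=> x k Omx; apply: le_trans (hM (`|M| + 1) _ x Omx); last first.
  by apply: le_lt_trans (ler_norm M) _; rewrite ltrDl.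
have /mapP[j Hj ->] : `|x 0 k| \in [seq `|x y.1 y.2| | y : 'I_1 * 'I_d].
  by apply/mapP; exists (0, k) => //=; rewrite mem_enum.
by rewrite [leRHS]/Num.Def.normr /= mx_normrE; apply/bigmax_geP; right => /=; exists j.
Qed.

Lemma nice_Vh u : Vh Om Ts u -> nice u.
Proof.
move=> uV; split; first exact: borel_fun_continuous uV.1.
have [r r0 hr] := bounded_coords.
exists r, (\sum_(T <- Ts) \sum_k `|u (T k)|); split; first exact: ltW.
split=> [x|x k rk]; first exact: normr_Vh_le.
apply: uV.2.1 => Omx; have := hr x k Omx; by rewrite leNgt rk.
Qed.

Lemma nice_VhM u v : Vh Om Ts u -> Vh Om Ts v -> nice (fun x => u x * v x).
Proof.
move=> uV vV; apply: (niceM (nice_Vh vV)); first exact: (nice_Vh uV).1.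
by move=> x; exact: normr_Vh_le.
Qed.

Lemma l2ipE u v : Vh Om Ts u -> l2ip Om u v = iint (fun x => u x * v x).
Proof.
move=> uV; apply: eq_iint => x; rewrite indicE; have [Omx|Omx] := pselect (Om x).
  by rewrite mem_set// mul1r.
by rewrite uV.2.1// mul0r mulr0.
Qed.

(** * Comparison of the squared L2 norm with the sum of squared nodal values *)

Section Nodal.
Variables (n : nat) (p : 'I_n -> pt).
Hypothesis pinj : injective p.
Hypothesis pvert : forall i, is_vertex Ts (p i) /\ Om (p i).
Hypothesis pall : forall x, is_vertex Ts x -> Om x -> exists i, p i = x.

Lemma sqr_Vh_le u x : Vh Om Ts u ->
  u x ^+ 2 <= \sum_i u (p i) ^+ 2 * \1_(box (p i - const_mx h) (2 * h)) x.
Proof.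
move=> uV.
have t0 i : 0 <= u (p i) ^+ 2 * \1_(box (p i - const_mx h) (2 * h)) x.
  by rewrite mulr_ge0 ?sqr_ge0// indicE ler0n.
have [Omx|Omx] := pselect (Om x); last first.
  by rewrite uV.2.1// expr0n /=; exact: sumr_ge0.
have [T TTs Tx] := (mesh_cover x).1 (subset_closure Omx).
have [b [w ubw]] := uV.2.2 T TTs.
have [k uk] := normr_affine_on_hull (mesh_nondegenerate TTs) ubw Tx.
(* A vertex outside [Om] carries no node, but [u] is zero there; as this vertex value dominates
   [|u x|], the left side is then 0. *)
have [OmTk|OmTk] := pselect (Om (T k)); last first.
  move: uk; rewrite [u (T k)]uV.2.1// normr0 normr_le0 => /eqP ->.
  by rewrite expr0n /=; exact: sumr_ge0.
have [i pi] : exists i, p i = T k by apply: pall => //; exists T => //; exists k.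
rewrite (bigD1 i)//= ler_wpDr//; first exact: sumr_ge0.
rewrite indicE mem_set ?mulr1; last first.
  move=> j; have := vertex_dist k j TTs Tx; rewrite !mxE pi ler_norml.
  by move=> /andP[h1 h2]; apply/andP; split; lra.
by rewrite pi -[leLHS]real_normK ?num_real// -[leRHS]real_normK ?num_real// lerXn2r ?nnegrE.
Qed.

(** Each cube has volume [(2 * h) ^+ d]; the sum is integrated term by term, so overlaps of the
    cubes need no counting. *)
Lemma iint_sqr_Vh_le u : 0 <= h -> Vh Om Ts u ->
  iint (fun x => u x * u x) <= 2 ^+ d * h ^+ d * \sum_i u (p i) ^+ 2.
Proof.
move=> h0 uV.
have nb i : nice (fun x => u (p i) ^+ 2 * \1_(box (p i - const_mx h) (2 * h)) x).
  by apply: niceZ; exact: nice_box.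
apply: (@le_trans _ _ (iint (fun x =>
    \sum_i u (p i) ^+ 2 * \1_(box (p i - const_mx h) (2 * h)) x))).
  apply: le_iint; [exact: nice_VhM|exact: nice_sum|].
  by move=> x; rewrite -expr2; exact: sqr_Vh_le.
rewrite iint_sum// mulr_sumr; apply: ler_sum => i _.
rewrite iintZ; last exact: nice_box.
by rewrite iint_box ?mulr_ge0// exprMn mulrC.
Qed.

Variables (rho : R).
Hypotheses (rho0 : 0 < rho) (qu : quasi_uniform rho Ts) (d0 : (0 < d)%N).

(** Chosen so that the cube of half-side [2 * side] fits into a ball of radius [rho * h]: the
    Euclidean norm is at most the sum of the coordinates, here [2 * side * d <= rho * h]. *)
Definition side : R := rho * h / (2 * d.+1%:R).
(** Satisfies [distortion >= 1] and [distortion * (side / 2) = h + side / 2]: a slope acting over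
    length [side / 2] is thereby compared with the same slope acting over length [h]. *)
Definition distortion : R := 1 + 4 * d.+1%:R / rho.

(* In the cube inscribed in [T], take the corner where every term of the affine function
   [u] has the sign of its value at the centre. *)
Lemma large_corner u i : Vh Om Ts u ->
  exists T, T \in Ts /\ p i \in codom T /\ exists a : pt, forall y, box a (side / 2) y ->
    (forall l, 0 < bary T y l) /\ `|u (p i)| <= distortion * `|u y|.
Proof.
move=> uV; have [[T TTs [k pk]] Omp] := pvert i.
have h0 : 0 < h := mesh_gt0 d0 TTs.
have D0 : 0 < d.+1%:R :> R by rewrite ltr0n.
have s0 : 0 < side by rewrite divr_gt0 ?mulr_gt0.
have ndT := mesh_nondegenerate TTs.
have [c hc] := qu TTs.
have cubeT (y : pt) : (forall j, `|c 0 j - y 0 j| <= 2 * side) -> hull T y.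
  move=> hy; apply: hc; apply: le_trans (enorm_le_sum _) _.
  apply: (@le_trans _ _ (\sum_(j < d) 2 * side)).
    by apply: ler_sum => j _; rewrite !mxE distrC.
  rewrite sumr_const card_ord -[_ *+ d]mulr_natr /side -/h.
  have -> : 2 * (rho * h / (2 * d.+1%:R)) * d%:R = rho * h * (d%:R / d.+1%:R).
    by field; rewrite addrC natr1 pnatr_eq0.
  rewrite ler_piMr ?mulr_ge0 ?ltW// ltr_pdivrMr// mul1r ltr_nat //.
have cT : hull T c by apply: cubeT => j; rewrite subrr normr0 mulr_ge0 ?ltW.
have [b [w ubw]] := uV.2.2 T TTs.
(* The sign of [u c], taken to be 1 at 0 so that [g] is always a unit. *)
pose g : R := if 0 <= u c then 1 else -1.
have gn r : g * r <= `|r|.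
  rewrite /g; case: ifP => _; first by rewrite mul1r ler_norm.
  by rewrite mulN1r -normrN ler_norm.
have guc : g * u c = `|u c|.
  rewrite /g; case: ifPn => uc0; first by rewrite mul1r ger0_norm.
  by rewrite mulN1r ltr0_norm// ltNge.
exists T; split=> //; split; first by rewrite pk codom_f.
(* Coordinate [j] of the cube runs over [[c + side/2, c + side]] or [[c - side, c - side/2]],
   according to the sign of [g * w j]. Every term of [edot w (y - c)] then adds at least
   [side / 2 * |w j|] in the direction of [u c]. *)
exists (\row_j (if 0 <= g * w 0 j then c 0 j + side / 2 else c 0 j - side)) => y hy.
have yc j : `|c 0 j - y 0 j| <= side /\ side / 2 * `|w 0 j| <= g * (w 0 j * (y 0 j - c 0 j)).
  have := hy j; rewrite !mxE => /andP[h1 h2].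
  have gw : `|w 0 j| = `|g * w 0 j|.
    by rewrite normrM /g; case: ifP => _; rewrite ?normrN normr1 mul1r.
  rewrite gw mulrA; move: h1 h2; case: ifPn => gw0 h1 h2.
    split; first by rewrite ler_norml; apply/andP; split; lra.
    by rewrite (ger0_norm gw0) mulrC; apply: ler_wpM2l => //; lra.
  rewrite -ltNge in gw0.
  split; first by rewrite ler_norml; apply/andP; split; lra.
  rewrite (ltr0_norm gw0) mulrN -mulNr mulrC; apply: ler_wnM2l; [exact: ltW|lra].
split.
  (* A point within [side] of [y] is within [2 * side] of [c], hence still in [T]; so [y] is
     interior. *)
  apply: (nbhs_bary_gt0 ndT s0) => z hz; apply: cubeT => j.
  apply: le_trans (ler_distD (y 0 j) _ _) _.
  by have := hz j; have := (yc j).1; lra.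
have Ty : hull T y by apply: cubeT => j; have := (yc j).1; lra.
pose W := \sum_j `|w 0 j|; have W0 : 0 <= W by exact: sumr_ge0.
have lb : `|u c| + side / 2 * W <= `|u y|.
  apply: le_trans (gn _).
  have -> : u y = u c + edot w (y - c) by rewrite !ubw// edotBr; ring.
  rewrite mulrDr guc lerD2l /W /edot !mulr_sumr; apply: ler_sum => j _.
  by rewrite !mxE; exact: (yc j).2.
have ub : `|u (p i)| <= `|u c| + h * W.
  have Tp : hull T (p i) by rewrite pk; exact: hull_vertex.
  have -> : u (p i) = u c + edot w (p i - c) by rewrite !ubw// edotBr; ring.
  apply: le_trans (ler_normD _ _) _; rewrite lerD2l mulrC.
  apply: normr_edot_le => j; rewrite !mxE pk distrC.
  exact: vertex_dist.
have K0 : 0 <= distortion by rewrite addr_ge0// divr_ge0 ?mulr_ge0 ?ltW.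
apply: le_trans (ler_wpM2l K0 lb); apply: (le_trans ub).
rewrite mulrDr lerD//.
  by rewrite ler_peMl// /distortion lerDl divr_ge0 ?mulr_ge0 ?ltW.
rewrite mulrA ler_wpM2r//.
have -> : distortion * (side / 2) = h + side / 2.
  rewrite /distortion /side -/h; field.
  by rewrite (gt_eqF rho0) addrC natr1 pnatr_eq0.
by rewrite lerDl divr_ge0// ltW.
Qed.

Lemma iint_sqr_Vh_ge u : Vh Om Ts u ->
  (side / 2) ^+ d * \sum_i u (p i) ^+ 2 <=
  d.+1%:R * distortion ^+ 2 * iint (fun x => u x * u x).
Proof.
move=> uV.
have /choice[T hT] := fun i => large_corner i uV.
have /choice[a ha] := fun i => (hT i).2.2.
have s0 (i : 'I_n) : 0 <= side / 2.
  have [[T' TTs _] _] := pvert i; have h0 := mesh_gt0 d0 TTs.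
  by rewrite !divr_ge0 ?mulr_ge0 ?ltW// ltr0n.
have K0 : 0 <= distortion by rewrite addr_ge0// divr_ge0 ?mulr_ge0 ?ler0n// ltW.
pose f i x : R := u (p i) ^+ 2 * \1_(box (a i) (side / 2)) x.
have nf i : nice (f i) by apply: niceZ; exact: nice_box.
have -> : (side / 2) ^+ d * \sum_i u (p i) ^+ 2 = iint (fun x => \sum_i f i x).
  rewrite iint_sum// mulr_sumr; apply: eq_bigr => i _.
  rewrite iintZ; last exact: nice_box.
  by rewrite iint_box ?s0// mulrC.
rewrite -iintZ; last exact: nice_VhM.
apply: le_iint; [exact: nice_sum|by apply: niceZ; exact: nice_VhM|].
(* Pointwise form of the bound: [I] collects the cubes containing [y]. Each contributes at most
   [distortion ^+ 2 * u y ^+ 2], so it remains to show that [I] has at most [d + 1] elements. *)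
move=> y; pose I := [set i | `[< box (a i) (side / 2) y >]]%SET.
have -> : \sum_i f i y = \sum_(i in I) u (p i) ^+ 2.
  rewrite [RHS]big_mkcond; apply: eq_bigr => i _; rewrite /f indicE inE.
  case: asboolP => hi; first by rewrite mem_set// mulr1.
  by rewrite memNset// mulr0.
apply: (@le_trans _ _ (\sum_(i in I) distortion ^+ 2 * (u y * u y))).
  apply: ler_sum => i; rewrite inE => /asboolP hi.
  rewrite -expr2 -exprMn -[leLHS]real_normK ?num_real//.
  rewrite -[leRHS]real_normK ?num_real// lerXn2r ?nnegrE//.
  by rewrite normrM (ger0_norm K0); exact: (ha i y hi).2.
rewrite sumr_const -[_ *+ _]mulr_natl -[leRHS]mulrA; apply: ler_wpM2r.
  by rewrite mulr_ge0 ?sqr_ge0// -expr2 sqr_ge0.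
rewrite ler_nat.
have [->|[i0 i0I]] := set_0Vmem I; first by rewrite cards0.
(* The nodes indexed by [I] are distinct; they are shown to be vertices of the single simplex
   [T i0]. *)
rewrite -(size_codom_simplex (T i0)) cardE -(size_map p); apply: uniq_leq_size.
  by rewrite map_inj_uniq// enum_uniq.
move=> _ /mapP[i + ->]; rewrite mem_enum inE => /asboolP hi.
move: i0I; rewrite inE => /asboolP hi0.
have [TTs [/codom_simplexP[k pk] _]] := hT i.
have [TTs0 _] := hT i0.
have [<-|TT] := eqVneq (T i) (T i0); first by rewrite pk codom_f.
have bi := (ha i y hi).1; have bi0 := (ha i0 y hi0).1.
(* The point [y] lies in both simplices, hence in the hull of their common vertices. Were [p i] not
   common, the coordinate of [y] at [p i] would vanish, although [y] is interior to [T i]. *)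
have : Defs.conv [seq v <- codom (T i) | v \in codom (T i0)] y.
  rewrite -(tri.2.2 _ _ TTs TTs0 TT); split.
    by apply/(hullP (mesh_nondegenerate TTs)) => l; exact: ltW.
  by apply/(hullP (mesh_nondegenerate TTs0)) => l; exact: ltW.
move=> cy; apply: contraT => pi0.
have := bi k; rewrite (conv_missing_vertex (mesh_nondegenerate TTs) _ _ cy) ?ltxx//.
  by move=> v; rewrite mem_filter => /andP[].
by rewrite mem_filter -pk (negbTE pi0).
Qed.

End Nodal.
End Mesh.

(** * The stiffness matrix *)

Section Stiffness.
Variables (R : realType) (d : nat) (Om : set 'rV[R]_d) (Ts : seq (simplex R d)).
Local Notation pt := 'rV[R]_d.
Hypotheses (tri : triangulation Om Ts) (oOm : open Om) (bOm : bounded_set Om).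
Hypothesis d0 : (0 < d)%N.

Lemma derive_affine_nbhs (u : pt -> R) b (w x v : pt) (e : R) : 0 < e ->
  (forall y : pt, (forall k, `|x 0 k - y 0 k| < e) -> u y = b + edot w y) ->
  'D_v u x = edot w v.
Proof.
move=> e0 ue; rewrite /derive; apply: cvg_lim => //.
apply: cvg_near_cst.
pose S := 1 + \sum_k `|v 0 k|.
have S0 : 0 < S by rewrite ltr_pwDl// sumr_ge0.
have eS : 0 < e / S by rewrite divr_gt0.
near=> t.
have t0 : t != 0 by near: t; exact: nbhs_dnbhs_neq.
have te : `|t| < e / S by near: t; exact: dnbhs0_lt.
rewrite /= /shift /= ue.
  rewrite ue => [|k]; last by rewrite subrr normr0.
  rewrite edotDr edotZr opprD addrACA subrr add0r addrK.
  by rewrite /GRing.scale /= mulrA mulVf// mul1r.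
move=> k; rewrite !mxE addrC opprD addNKr normrN normrM.
apply: (@le_lt_trans _ _ (`|t| * S)); last by rewrite -ltr_pdivlMr.
rewrite ler_wpM2l// /S (bigD1 k)//=.
by have : 0 <= \sum_(i | i != k) `|v 0 i|; [exact: sumr_ge0|lra].
Unshelve. all: by end_near.
Qed.

Lemma derive_Vh_inside u T b (w x v : pt) : T \in Ts ->
  (forall y, hull T y -> u y = b + edot w y) -> (forall k, 0 < bary T x k) ->
  'D_v u x = edot w v.
Proof.
move=> TTs ubw bx; have ndT := mesh_nondegenerate tri TTs.
have [e e0 he] := bary_gt0_nbhs bx.
apply: (derive_affine_nbhs (b := b) v e0) => y hy.
by apply/ubw/(hullP ndT) => k; apply/ltW; exact: he.
Qed.

Lemma derive_Vh_outside u (x v : pt) : Vh Om Ts u -> ~ closure Om x -> 'D_v u x = 0.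
Proof.
move=> uV Omx.
have oC : open (~` closure Om) by apply: closed_openC; exact: closed_closure.
have [e e0 he] := open_ballP oC Omx.
rewrite (@derive_affine_nbhs u 0 0 x v e) => [|//|y hy].
  exact: edot0l.
rewrite uV.2.1 ?edot0l ?addr0//.
by move=> Omy; apply: (he y hy); exact: subset_closure.
Qed.

(** Takes the full hyperplanes spanned by the facets rather than the facets alone, so that
    [exceptional_hyperplane] applies directly. *)
Definition skeleton : set pt := [set x | exists2 T, T \in Ts & exists k, bary T x k = 0].

Lemma exceptional_seqU (I : eqType) (s : seq I) (N : I -> set pt) :
  (forall i, i \in s -> exceptional (N i)) ->
  exceptional [set x | exists2 i, i \in s & N i x].
Proof.
elim: s => [|i s IH] hs.
  have -> : [set x | exists2 i, i \in [::] & N i x] = set0.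
    by apply/seteqP; split=> x // [].
  exact: exceptional0.
have -> : [set x | exists2 j, j \in i :: s & N j x] =
    N i `|` [set x | exists2 j, j \in s & N j x].
  apply/seteqP; split=> x /=.
    move=> [j]; rewrite in_cons => /orP[/eqP ->|js] Njx; first by left.
    by right; exists j.
  move=> [Nix|[j js Njx]]; first by exists i => //; rewrite mem_head.
  by exists j => //; rewrite in_cons js orbT.
apply: exceptionalU; first by apply: hs; rewrite mem_head.
by apply: IH => j js; apply: hs; rewrite in_cons js orbT.
Qed.

Lemma exceptional_skeleton : exceptional skeleton.
Proof.
apply: (@exceptional_seqU _ Ts (fun T => [set x | exists k, bary T x k = 0])) => T TTs.
have -> : [set x | exists k, bary T x k = 0] =
    [set x | exists2 k, k \in enum 'I_d.+1 & bary T x k = 0].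
  apply/seteqP; split=> x /= [k]; last by move=> _; exists k.
  by exists k => //; rewrite mem_enum.
apply: (@exceptional_seqU _ _ (fun k => [set x | bary T x k = 0])) => k _.
exact: exceptional_facets (mesh_nondegenerate tri TTs) k.
Qed.

Lemma bary_gt0_off_skeleton T x : T \in Ts -> hull T x -> ~ skeleton x ->
  forall k, 0 < bary T x k.
Proof.
move=> TTs Tx Nx k; have /(hullP (mesh_nondegenerate tri TTs))/(_ k) := Tx.
rewrite le_eqVlt => /orP[/eqP b0|//].
by exfalso; apply: Nx; exists T => //; exists k.
Qed.

(** The value [W T] of the first simplex in the list that contains [x], and 0 if there is none.
    Writing it with indicators of closed sets makes it visibly Borel. *)
Fixpoint piecewise (W : simplex R d -> R) (s : seq (simplex R d)) (x : pt) : R :=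
  if s is T :: s' then
    \1_(hull T) x * W T + (1 - \1_(hull T) x) * piecewise W s' x
  else 0.

Lemma borel_fun_piecewise W s : {subset s <= Ts} -> borel_fun (piecewise W s).
Proof.
elim: s => [|T s IH] sTs /=; first exact: borel_fun_cst.
have cT : borel_fun (\1_(hull T) : pt -> R).
  apply: borel_fun_indic_closed; apply: closed_hull (mesh_nondegenerate tri _).
  by apply: sTs; rewrite mem_head.
apply: borel_funD; first by apply: borel_funM => //; exact: borel_fun_cst.
apply: borel_funM; last by apply: IH => T' T's; apply: sTs; rewrite in_cons T's orbT.
apply: borel_funD; first exact: borel_fun_cst.
move=> disp X f mf; apply: measurable_funN; exact: cT.
Qed.

Lemma normr_piecewise_le W s x : `|piecewise W s x| <= \sum_(T <- s) `|W T|.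
Proof.
elim: s => [|T s IH] /=; first by rewrite big_nil normr0.
rewrite big_cons indicE; case: (x \in hull T).
  by rewrite mul1r subrr mul0r addr0 lerDl sumr_ge0.
by rewrite mul0r add0r subr0 mul1r ler_wpDl.
Qed.

Lemma piecewise_in W s x T : T \in s -> hull T x ->
  exists T', [/\ T' \in s, hull T' x & piecewise W s x = W T'].
Proof.
elim: s => //= T1 s IH; rewrite in_cons => Ts1 Tx; rewrite indicE.
have [T1x|T1x] := pselect (hull T1 x).
  by exists T1; rewrite mem_head mem_set// mul1r subrr mul0r addr0.
rewrite memNset// mul0r add0r subr0 mul1r.
have Ts' : T \in s by case/orP: Ts1 => // /eqP TT1; move: Tx; rewrite TT1.
have [T' [T's T'x ->]] := IH Ts' Tx.
by exists T'; rewrite in_cons T's orbT.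
Qed.

Lemma piecewise_out W s x : (forall T, T \in s -> ~ hull T x) -> piecewise W s x = 0.
Proof.
elim: s => //= T s IH hs; rewrite indicE memNset; last by apply: hs; rewrite mem_head.
rewrite mul0r add0r subr0 mul1r IH// => T' T's.
by apply: hs; rewrite in_cons T's orbT.
Qed.

(** Off the skeleton a point is interior to every simplex containing it, so the derivative is given
    by whichever of them [piecewise] selects; outside the closure of [Om] both sides are 0. *)
Lemma derive_Vh_piecewise u (w : simplex R d -> pt) k x :
  Vh Om Ts u ->
  (forall T, T \in Ts -> exists b, forall y, hull T y -> u y = b + edot (w T) y) ->
  ~ skeleton x -> 'D_(unit_vec R k) u x = piecewise (fun T => w T 0 k) Ts x.
Proof.
move=> uV uw Nx.
have [/(mesh_cover tri)[T TTs Tx]|Omx] := pselect (closure Om x).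
  have [T' [T'Ts T'x ->]] := piecewise_in (fun T => w T 0 k) TTs Tx.
  have [b ubw] := uw T' T'Ts.
  rewrite (derive_Vh_inside _ T'Ts ubw); first exact: edot_delta.
  exact: bary_gt0_off_skeleton.
rewrite derive_Vh_outside// piecewise_out// => T TTs Tx.
by apply: Omx; apply/(mesh_cover tri); exists T.
Qed.

Lemma barycenter_interior T : T \in Ts -> exists x, forall k, 0 < bary T x k.
Proof.
move=> TTs; have ndT := mesh_nondegenerate tri TTs.
exists (\sum_(l < d.+1) d.+1%:R^-1 *: T l) => k.
have [b [w bw]] := bary_affine T k.
rewrite bw affine_comb; last first.
  by rewrite sumr_const card_ord -[_ *+ _]mulr_natr mulVf// pnatr_eq0.
under eq_bigr do rewrite -bw (bary_vertex ndT).
rewrite (bigD1 k)//= eqxx mulr1 ltr_wpDr ?invr_gt0 ?ltr0n//.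
by apply: sumr_ge0 => j _; rewrite mulr_ge0 ?ler0n// invr_ge0.
Qed.

(** A simplex lies only in the closure of [Om]. Its barycentre is therefore approximated by a point
    of [Om] still interior to [T], around which both open conditions leave room for a cube. *)
Lemma box_inside T : T \in Ts ->
  exists a s, 0 < s /\ forall y, @box R d a s y -> Om y /\ hull T y.
Proof.
move=> TTs; have ndT := mesh_nondegenerate tri TTs.
have [x bx] := barycenter_interior TTs.
have [e e0 he] := bary_gt0_nbhs bx.
have Omx : closure Om x.
  by apply/(mesh_cover tri); exists T => //; apply/(hullP ndT) => k; exact: ltW.
have nx : nbhs x (ball x e) by exact: nbhsx_ballx.
have [z [Omz /(mx_ballE x z e0) zx]] := Omx _ nx.
have [e1 e10 he1] := bary_gt0_nbhs (he z zx).
have [e2 e20 he2] := open_ballP oOm Omz.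
pose m := Num.min e1 e2; have m0 : 0 < m by rewrite lt_min e10.
exists z, (m / 2); split; first by rewrite divr_gt0.
move=> y hy.
have zy k : `|z 0 k - y 0 k| < m.
  by have /andP[h1 h2] := hy k; rewrite ltr_norml; apply/andP; split; lra.
split; first by apply: he2 => k; apply: lt_le_trans (zy k) _; rewrite ge_min lexx orbT.
apply/(hullP ndT) => k; apply/ltW/he1 => j.
by apply: lt_le_trans (zy j) _; rewrite ge_min lexx.
Qed.

(** * Vanishing of piecewise constant finite element functions *)

Lemma exists_notin_seq (s : seq R) (a b : R) : a < b ->
  exists v, [/\ a < v, v < b & v \notin s].
Proof.
elim: s b => [|r s IH] b ab; first by exists ((a + b) / 2); split=> //; lra.
have [/andP[ar rb]|nr] := boolP (a < r < b).
  have [v [av vr vs]] := IH r ar; exists v; split=> //; first exact: lt_trans rb.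
  by rewrite in_cons negb_or vs andbT lt_eqF.
have [v [av vb vs]] := IH b ab; exists v; split=> //.
rewrite in_cons negb_or vs andbT; apply: contraNneq nr => <-.
by rewrite av vb.
Qed.

(** Between two distinct values lies a number outside the list, which the intermediate value theorem
    would make a value of [f]. *)
Lemma continuous_finite_range (f : R -> R) (s : seq R) : continuous f ->
  (forall t, f t \in s) -> forall a b, f a = f b.
Proof.
move=> cf fs.
suff lt a b : a <= b -> f a = f b.
  by move=> a b; have [/lt//|/ltW/lt->] := leP a b.
move=> ab; apply/eqP; apply: contraT => fab.
have mM : Num.min (f a) (f b) < Num.max (f a) (f b).
  by case: (ltgtP (f a) (f b)) fab.
have [v [mv vM vs]] := exists_notin_seq s mM.
have [||c _ fc] := @IVT R f a b v ab.
- exact: continuous_subspaceT.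
- by rewrite !ltW.
- by move: vs; rewrite -fc fs.
Qed.

Lemma continuous_line (u : pt -> R) (x v : pt) : continuous u ->
  continuous (fun t : R => u (x + t *: v)).
Proof.
move=> cu t A /(cu (x + t *: v)) hA.
have /nbhs_ballP[e /= e0 he] : nbhs (x + t *: v) (u @^-1` A) by exact: hA.
pose S := 1 + \sum_k `|v 0 k|.
have S0 : 0 < S by rewrite ltr_pwDl// sumr_ge0.
suff : nbhs t ((fun t => u (x + t *: v)) @^-1` A) by [].
apply/nbhs_ballP; exists (e / S) => /=; first by rewrite divr_gt0.
move=> t'; rewrite /ball /= => tt'; apply: he; apply/(mx_ballE _ _ e0) => k.
rewrite !mxE opprD addrACA subrr add0r -mulrBl normrM.
apply: (@le_lt_trans _ _ (`|t - t'| * S)); last by rewrite -ltr_pdivlMr.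
rewrite ler_wpM2l// /S (bigD1 k)//=.
by have : 0 <= \sum_(i | i != k) `|v 0 i|; [exact: sumr_ge0|lra].
Qed.

Lemma Vh_piecewise_cst u : Vh Om Ts u ->
  (forall T, T \in Ts -> exists b, forall x, hull T x -> u x = b) ->
  forall x, u x = 0.
Proof.
move=> uV uc x.
have [r r0 hr] := bounded_coords bOm.
pose y : pt := const_mx (r + 1).
have uy : u y = 0.
  apply: uV.2.1 => /(hr y (Ordinal d0)); rewrite mxE ger0_norm; last lra.
  by rewrite gerDl ler10.
(* All possible values of [u]: 0 outside [Om], and on each simplex its value at one vertex. The line
   from the outside point [y] to [x] then reduces the claim to one variable. *)
pose s := 0 :: [seq u ((T : simplex R d) ord0) | T <- Ts].
have us z : u z \in s.
  have [Omz|Omz] := pselect (Om z); last by rewrite uV.2.1// mem_head.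
  have [T TTs Tz] := (mesh_cover tri z).1 (subset_closure Omz).
  have [b ub] := uc T TTs.
  rewrite in_cons (ub z Tz) -(ub (T ord0)); last first.
    exact: hull_vertex (mesh_nondegenerate tri TTs) ord0.
  by rewrite (map_f (fun T : simplex R d => u (T ord0)) TTs) orbT.
have := @continuous_finite_range (fun t => u (y + t *: (x - y))) s
  (continuous_line uV.1) (fun t => us _) 1 0.
by rewrite /= scale1r addrC subrK scale0r addr0 uy.
Qed.

Variables (n : nat) (p : 'I_n -> pt) (phi : 'I_n -> pt -> R).
Hypothesis phiV : forall i, Vh Om Ts (phi i).
Hypothesis phi_p : forall i j, phi i (p j) = (i == j)%:R.

Lemma nice_indic_Om : nice (\1_Om : pt -> R).
Proof.
split; first exact: borel_fun_indic_open.
have [r r0 hr] := bounded_coords bOm.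
exists r, 1; split; first exact: ltW.
split=> [x|x k rk]; first by rewrite indicE normr_nat lern1 leq_b1.
by rewrite indicE memNset// => /(hr x k); rewrite leNgt rk.
Qed.

(** The double sum is the Dirichlet energy of the combination [u] of the [phi i]. Zero energy forces
    a zero gradient on each simplex, hence [u = 0], and the value of [u] at [p j] is [x j]. *)
Lemma gradip_definite (x : 'I_n -> R) :
  \sum_i \sum_j x i * x j * gradip Om (phi i) (phi j) = 0 -> forall i, x i = 0.
Proof.
move=> xK.
have /choice[w hw] : forall i, exists w : simplex R d -> pt, forall T, T \in Ts ->
    exists b, forall y, hull T y -> phi i y = b + edot (w T) y.
  move=> i.
  (* A gradient is selected for every simplex at once, with 0 as filler outside [Ts]. *)
  have /choice[w hw] : forall T : simplex R d, exists w : pt, T \in Ts ->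
      exists b, forall y, hull T y -> phi i y = b + edot w y.
    move=> T; have [TTs|TTs] := boolP (T \in Ts); last by exists 0.
    by have [b [w bw]] := (phiV i).2.2 T TTs; exists w => _; exists b.
  by exists w.
pose G i k := piecewise (fun T => w i T 0 k) Ts.
pose M i k := \sum_(T <- Ts) `|w i T 0 k|.
have cG i k : borel_fun (G i k) by exact: borel_fun_piecewise.
have GM i k y : `|G i k y| <= M i k by exact: normr_piecewise_le.
have DG i k y : ~ skeleton y -> 'D_(unit_vec R k) (phi i) y = G i k y.
  by move=> Ny; apply: derive_Vh_piecewise => // T; exact: hw.
pose g i j y : R := (\sum_k G i k y * G j k y) * \1_Om y.
have ng i j : nice (g i j).
  apply: (niceM (M' := \sum_k M i k * M j k) nice_indic_Om).
    by apply: borel_fun_sum => k; exact: borel_funM.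
  move=> y; apply: le_trans (ler_norm_sum _ _ _) _; apply: ler_sum => k _.
  by rewrite normrM; exact: ler_pM.
have gE i j : gradip Om (phi i) (phi j) = iint (g i j).
  apply: (eq_iint_exceptional exceptional_skeleton (ng i j).1) => y Ny.
  by rewrite /g mulrC; congr (_ * _); apply: eq_bigr => k _; rewrite !DG.
pose F y : R := \sum_i \sum_j x i * x j * g i j y.
have nF : nice F by apply: nice_sum => i; apply: nice_sum => j; exact: niceZ.
have F0 : iint F = 0.
  rewrite -[RHS]xK iint_sum => [|i]; last by apply: nice_sum => j; exact: niceZ.
  apply: eq_bigr => i _; rewrite iint_sum => [|j]; last exact: niceZ.
  by apply: eq_bigr => j _; rewrite iintZ// gE.
have FE y : F y = (\sum_k (\sum_i x i * G i k y) ^+ 2) * \1_Om y.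
  transitivity (\sum_i \sum_j \sum_k (x i * G i k y) * (x j * G j k y) * \1_Om y).
    apply: eq_bigr => i _; apply: eq_bigr => j _; rewrite /g mulr_suml mulr_sumr.
    by apply: eq_bigr => k _; ring.
  under eq_bigr do rewrite exchange_big /=.
  rewrite exchange_big /= mulr_suml; apply: eq_bigr => k _.
  rewrite expr2 big_distrlr /= mulr_suml; apply: eq_bigr => i _.
  by rewrite mulr_suml; apply: eq_bigr => j _.
have Fge0 y : 0 <= F y.
  rewrite FE mulr_ge0 ?indicE ?ler0n//; apply: sumr_ge0 => k _; exact: sqr_ge0.
(* Localisation to a cube inside [T] and [Om]: off the skeleton [F] is there the constant [m], the
   squared norm of the gradient of the combination. Hence [m * s ^+ d] is at most the total energy
   0. *)
have w0 T k : T \in Ts -> \sum_i x i * w i T 0 k = 0.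
  move=> TTs; have [a [s [s0 hs]]] := box_inside TTs.
  pose m := \sum_k (\sum_i x i * w i T 0 k) ^+ 2.
  have nm : nice (fun y => m * \1_(box a s) y) by apply: niceZ; exact: nice_box.
  have : iint (fun y => \1_(box a s) y * F y) <= 0.
    rewrite -F0; apply: le_iint => //.
      apply: (niceM (M' := 1)) => //; first exact: (nice_box a s).1.
      by move=> y; rewrite indicE normr_nat lern1 leq_b1.
    by move=> y; rewrite indicE; case: (y \in _); rewrite ?mul1r// mul0r.
  have -> : iint (fun y => \1_(box a s) y * F y) = iint (fun y => m * \1_(box a s) y).
    apply: (eq_iint_exceptional exceptional_skeleton nm.1) => y Ny.
    rewrite mulrC indicE; have [by_|by_] := pselect (box a s y); last first.
      by rewrite memNset// !mulr0.
    have [Omy Ty] := hs y by_.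
    rewrite mem_set// !mulr1 FE indicE mem_set// mulr1.
    apply: eq_bigr => l _; congr (_ ^+ 2); apply: eq_bigr => i _; congr (_ * _).
    have [b bw] := hw i T TTs.
    rewrite -DG// (derive_Vh_inside _ TTs bw); first exact: edot_delta.
    exact: bary_gt0_off_skeleton.
  rewrite iintZ; last exact: nice_box.
  rewrite (iint_box a (ltW s0)) pmulr_lle0 ?exprn_gt0// => m0.
  have : m == 0 by rewrite eq_le m0; apply: sumr_ge0 => l _; exact: sqr_ge0.
  rewrite psumr_eq0; last by move=> l _; exact: sqr_ge0.
  by move/allP/(_ k (mem_index_enum _)); rewrite sqrf_eq0 => /eqP.
pose u y := \sum_i x i * phi i y.
have uV : Vh Om Ts u by exact: Vh_sum.
have u0 : forall y, u y = 0.
  apply: Vh_piecewise_cst => // T TTs.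
  have /choice[b hb] : forall i, exists b, forall y, hull T y -> phi i y = b + edot (w i T) y.
    by move=> i; exact: hw.
  exists (\sum_i x i * b i) => y Ty.
  transitivity (\sum_i (x i * b i) + edot (\sum_i x i *: w i T) y).
    rewrite edotC edot_sumr -big_split; apply: eq_bigr => i _ /=.
    by rewrite (hb i y Ty) edotZr (edotC y) mulrDr.
  rewrite [X in edot X _](_ : _ = 0); first by rewrite edot0l addr0.
  apply/rowP => k; rewrite summxE mxE -[RHS](w0 T k TTs).
  by apply: eq_bigr => i _; rewrite mxE.
move=> j; rewrite -[RHS](u0 (p j)) /u (bigD1 j)//= phi_p eqxx mulr1 big1 ?addr0//.
by move=> i ij; rewrite phi_p (negbTE ij) mulr0.
Qed.

End Stiffness.

(** * The field of values *)

Section FieldOfValues.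
Variables (R : realType) (n : nat).
Local Open Scope complex_scope.

Definition quad (S : 'M[R]_n) (v : 'cV[R]_n) : R := (v^T *m S *m v) 0 0.
Definition re_vec (x : 'cV[R[i]]_n) : 'cV[R]_n := map_mx (@complex.Re R) x.
Definition im_vec (x : 'cV[R[i]]_n) : 'cV[R]_n := map_mx (@complex.Im R) x.
Local Notation toC := (map_mx (real_complex R)).

Lemma quadE (S : 'M[R]_n) v : quad S v = \sum_i \sum_j v i 0 * v j 0 * S i j.
Proof.
rewrite /quad mxE; under eq_bigr do rewrite mxE mulr_suml.
rewrite exchange_big /=; apply: eq_bigr => i _; apply: eq_bigr => j _.
by rewrite mxE; ring.
Qed.

Lemma complex_vecE (x : 'cV[R[i]]_n) : x = toC (re_vec x) + 'i *: toC (im_vec x).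
Proof.
by apply/matrixP => i j; rewrite !mxE [LHS]complexE.
Qed.

Lemma adjvE (x : 'cV[R[i]]_n) : adjv x = toC (re_vec x)^T - 'i *: toC (im_vec x)^T.
Proof.
apply/matrixP => i j; rewrite !mxE.
by case: (x j i) => a b; apply/eqP; rewrite eq_complex /=; simpc.
Qed.

(** With [x = a + i b] the cross terms are [i (a^T S b - b^T S a)]; they cancel because [S] is
    symmetric. *)
Lemma quadC (S : 'M[R]_n) (x : 'cV[R[i]]_n) : S^T = S ->
  (adjv x *m toC S *m x) 0 0 = (quad S (re_vec x) + quad S (im_vec x))%:C.
Proof.
move=> symS; rewrite adjvE.
rewrite [X in _ *m X](complex_vecE x); set a := re_vec x; set b := im_vec x.
have ab : b^T *m S *m a = a^T *m S *m b.
  have -> : a^T *m S *m b = (a^T *m S *m b)^T.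
    by apply/matrixP => i j; rewrite !ord1 [RHS]mxE.
  by rewrite !trmx_mul trmxK symS mulmxA.
rewrite !mulmxBl !mulmxDr -!scalemxAl -!scalemxAr -!map_mxM /= ab /quad.
move: (a^T *m S *m a) (a^T *m S *m b) (b^T *m S *m b) => P Q T.
rewrite !mxE rmorphD /=.
transitivity ((P 0 0)%:C - 'i * 'i * (T 0 0)%:C); first by ring.
by rewrite -expr2 sqr_i; ring.
Qed.

Lemma quad1E (v : 'cV[R]_n) : quad 1%:M v = \sum_i v i 0 ^+ 2.
Proof.
rewrite quadE; apply: eq_bigr => i _; rewrite (bigD1 i)//= mxE eqxx mulr1.
by rewrite big1 ?addr0 ?expr2// => j ji; rewrite mxE eq_sym (negbTE ji) mulr0.
Qed.

Lemma quad1_ge0 (v : 'cV[R]_n) : 0 <= quad 1%:M v.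
Proof. by rewrite quad1E; apply: sumr_ge0 => i _; exact: sqr_ge0. Qed.

Lemma quad1_eq0 (v : 'cV[R]_n) : quad 1%:M v = 0 -> v = 0.
Proof.
rewrite quad1E => /eqP; rewrite psumr_eq0 => [/allP v0|i _]; last exact: sqr_ge0.
apply/matrixP => i j; rewrite ord1 mxE.
by have := v0 i (mem_index_enum _); rewrite sqrf_eq0 => /eqP.
Qed.

End FieldOfValues.

(** * Explicit constants and reduction to the Rayleigh quotient of the mass matrix *)

Theorem theorem4 (R : realType) (d : nat) (hd : d = 2%N \/ d = 3%N)
  (Om : set 'rV[R]_d) (hOm : polyhedral_domain Om)
  (rho : R) (hrho : 0 < rho) :
  exists c C : R, 0 < c /\ 0 < C /\
  forall (Ts : seq (simplex R d)) (kappa sigma : R) (n : nat)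
         (p : 'I_n -> 'rV[R]_d) (phi : 'I_n -> 'rV[R]_d -> R),
    triangulation Om Ts -> quasi_uniform rho Ts -> 0 < sigma ->
    nodal_basis Om Ts p phi ->
    forall z : R[i],
      field_of_values (Amat Om kappa sigma phi *m invmx (Kmat Om phi) *m Mmat Om phi) z ->
      c * mesh_size Ts ^+ d - kappa ^+ 2 / sigma * complex.Im z <= complex.Re z /\
      complex.Re z <= C * mesh_size Ts ^+ d - kappa ^+ 2 / sigma * complex.Im z.
Proof.
have d0 : (0 < d)%N by case: hd => ->.
have [oOm [_ [bOm _]]] := hOm.
have D0 : 0 < d.+1%:R :> R by rewrite ltr0n.
pose K := distortion d rho.
have K0 : 0 < K by rewrite /K /distortion addr_gt0// divr_gt0// mulr_gt0.
(* Read off [iint_sqr_Vh_ge]: [(side / 2) ^+ d] is [(rho / (4 * d.+1)) ^+ d * h ^+ d], and the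
   denominator is the factor in front of the integral. *)
pose c := (rho / (4 * d.+1%:R)) ^+ d / (d.+1%:R * K ^+ 2).
have c0 : 0 < c.
  by rewrite divr_gt0// ?exprn_gt0// ?mulr_gt0// ?exprn_gt0// divr_gt0// mulr_gt0.
exists c, (2 ^+ d); split=> //; split; first by rewrite exprn_gt0.
move=> Ts kappa sigma n p phi tri qu s0 [pinj [pv [pa [phiV phip]]]] z [x [xn0 ->]].
set h := mesh_size Ts.
have h0 : 0 <= h.
  exact: bigmax_ge_id.
pose M0 : 'M[R]_n := \matrix_(j, i) l2ip Om (phi i) (phi j).
pose K0m : 'M[R]_n := \matrix_(j, i) gradip Om (phi i) (phi j).
have symM : M0^T = M0.
  apply/matrixP => i j; rewrite !mxE; apply: eq_iint => y.
  by rewrite [phi i y * _]mulrC.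
have symK : K0m^T = K0m.
  apply/matrixP => i j; rewrite !mxE; apply: eq_iint => y; congr (_ * _).
  by apply: eq_bigr => k _; rewrite mulrC.
have uK : K0m \in unitmx.
  rewrite -row_free_unit; apply: inj_row_free => v vK.
  have vKv : \sum_i \sum_j v 0 i * v 0 j * gradip Om (phi i) (phi j) = 0.
    have := congr1 (fun A : 'rV_n => (A *m v^T) 0 0) vK; rewrite mul0mx mxE [RHS]mxE => E.
    rewrite -[RHS]E.
    under [RHS]eq_bigr do rewrite mxE mulr_suml.
    apply: eq_bigr => i _; apply: eq_bigr => j _; rewrite !mxE; ring.
  apply/rowP => i; rewrite mxE.
  exact: (gradip_definite tri oOm bOm d0 phiV phip vKv).
have bounds (v : 'cV[R]_n) :
    c * h ^+ d * quad 1%:M v <= quad M0 v <= 2 ^+ d * h ^+ d * quad 1%:M v.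
  (* For [u] with nodal values [v], [quad M0 v] is its squared L2 norm and [quad 1%:M v] the sum of
     its squared nodal values. *)
  pose u y := \sum_i v i 0 * phi i y.
  have uV : Vh Om Ts u by exact: Vh_sum.
  have up j : u (p j) = v j 0.
    rewrite /u (bigD1 j)//= phip eqxx mulr1 big1 ?addr0// => i ij.
    by rewrite phip (negbTE ij) mulr0.
  have -> : quad M0 v = iint (fun y => u y * u y).
    transitivity (iint (fun y => \sum_i \sum_j v i 0 * v j 0 * (phi i y * phi j y))).
      have nij i j : nice (fun y => v i 0 * v j 0 * (phi i y * phi j y)).
        by apply: niceZ; exact: (nice_VhM tri).
      rewrite quadE iint_sum => [|i]; last exact: nice_sum.
      apply: eq_bigr => i _; rewrite iint_sum//; apply: eq_bigr => j _.
      rewrite iintZ; last exact: (nice_VhM tri).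
      by rewrite -symM !mxE (l2ipE _ (phiV i)).
    apply: eq_iint => y; rewrite /u big_distrlr /=.
    by apply: eq_bigr => i _; apply: eq_bigr => j _; ring.
  have -> : quad 1%:M v = \sum_i u (p i) ^+ 2.
    by rewrite quad1E; apply: eq_bigr => i _; rewrite up.
  apply/andP; split; last exact: (iint_sqr_Vh_le tri bOm pa h0 uV).
  have := iint_sqr_Vh_ge tri bOm pinj pv hrho qu d0 uV.
  rewrite -ler_pdivrMl; last by rewrite mulr_gt0// exprn_gt0.
  apply: le_trans; rewrite mulrA; apply: ler_wpM2r; first by apply: sumr_ge0 => i _; exact: sqr_ge0.
  rewrite /side -/h -/K.
  have -> : rho * h / (2 * d.+1%:R) / 2 = rho / (4 * d.+1%:R) * h.
    by field; rewrite addrC natr1 pnatr_eq0.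
  by rewrite exprMn /c [leRHS]mulrCA -[leLHS]mulrA.
pose B := M0 *m invmx K0m *m M0.
have symB : B^T = B by rewrite /B !trmx_mul trmx_inv symM symK mulmxA.
have EK : Kmat Om phi = map_mx (real_complex R) K0m by apply/matrixP => i j; rewrite !mxE.
have EM : Mmat Om phi = map_mx (real_complex R) M0 by apply/matrixP => i j; rewrite !mxE.
have EA : Amat Om kappa sigma phi = map_mx (real_complex R) K0m
    + (- (kappa ^+ 2)%:C%C + 'i%C * sigma%:C%C) *: map_mx (real_complex R) M0.
  by apply/matrixP => i j; rewrite !mxE /aform complexiE !rmorphM /=; ring.
have EN : Amat Om kappa sigma phi *m invmx (Kmat Om phi) *m Mmat Om phi =
   map_mx (real_complex R) M0
   + (- (kappa ^+ 2)%:C%C + 'i%C * sigma%:C%C) *: map_mx (real_complex R) B.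
  rewrite EA EK EM mulmxDl mulmxDl -!scalemxAl -map_invmx -!map_mxM /= mulmxV//.
  by rewrite mul1mx.
have -> : (adjv x *m (Amat Om kappa sigma phi *m invmx (Kmat Om phi) *m Mmat Om phi) *m x) 0 0
    = (quad M0 (re_vec x) + quad M0 (im_vec x))%:C%C
      + (- (kappa ^+ 2)%:C%C + 'i%C * sigma%:C%C)
        * (quad B (re_vec x) + quad B (im_vec x))%:C%C.
  by rewrite EN mulmxDr mulmxDl -scalemxAr -scalemxAl mxE [X in _ + X]mxE !quadC.
have -> : (adjv x *m x) 0 0 = (quad 1%:M (re_vec x) + quad 1%:M (im_vec x))%:C%C.
  by rewrite -quadC ?trmx1// map_mx1 mulmx1.
set q1 := quad 1%:M (re_vec x) + _; set qM := quad M0 _ + _; set qB := quad B _ + _.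
have q10 : 0 < q1.
  rewrite lt_neqAle addr_ge0 ?quad1_ge0// andbT eq_sym.
  apply: contraNneq xn0 => /eqP; rewrite paddr_eq0 ?quad1_ge0//.
  move=> /andP[/eqP/quad1_eq0 r0 /eqP/quad1_eq0 i0].
  by rewrite (complex_vecE x) r0 i0 !map_mx0 scaler0 addr0.
have := bounds (re_vec x); have := bounds (im_vec x) => /andP[b1 b2] /andP[b3 b4].
have l1 : c * h ^+ d * q1 <= qM by rewrite mulrDr lerD.
have l2 : qM <= 2 ^+ d * h ^+ d * q1 by rewrite mulrDr lerD.
have -> : (qM%:C%C + (- (kappa ^+ 2)%:C%C + 'i%C * sigma%:C%C) * qB%:C%C) / q1%:C%C =
   (((qM - kappa ^+ 2 * qB) / q1) +i* (sigma * qB / q1))%C.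
  rewrite -fmorphV; apply/eqP; rewrite eq_complex /=.
  by apply/andP; split; apply/eqP; ring.
have sn0 : sigma != 0 by rewrite gt_eqF.
have q1n0 : q1 != 0 by rewrite gt_eqF.
rewrite /= !lerBlDr !lerBrDr.
(* The imaginary part is [sigma * qB / q1], so the weight [kappa ^+ 2 / sigma] cancels the whole
   contribution of [B] and leaves [qM / q1]. *)
have -> : (qM - kappa ^+ 2 * qB) / q1 + kappa ^+ 2 / sigma * (sigma * qB / q1) = qM / q1.
  by field; rewrite sn0 q1n0.
by rewrite ler_pdivlMr// ler_pdivrMr.
Qed.
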